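(* Let $1 \le p < 2$ and let $\beta \in \mathbb{R}$ satisfy $p\beta < 1$. Then every homeomorphism $\varphi \colon \partial\mathbb{D} \to \partial\mathbb{D}$ of the unit circle onto itself has an extension to a homeomorphism $h \colon \overline{\mathbb{D}} \to \overline{\mathbb{D}}$ of $\overline{\mathbb{D}}$ onto itself (so $h = \varphi$ on $\partial\mathbb{D}$) which is locally Lipschitz continuous in $\mathbb{D}$ and satisfies $$\int_{\mathbb{D}} \frac{|Dh(z)|^p}{(1-|h(z)|)^{p\beta}} \, dz < \infty .$$
   Context: $\mathbb{D}$ denotes the open unit disk in the complex plane $\mathbb{C}$. $|Dh(z)|$ is the operator norm of the differential matrix of $h$, which exists for a.e. $z \in \mathbb{D}$ by local Lipschitz continuity, and $dz$ denotes two-dimensional Lebesgue measure. *)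

(* Defs.v *)
From mathcomp Require Import all_boot all_order all_algebra.
From mathcomp Require Import all_classical all_reals all_analysis.
Import Order.TTheory GRing.Theory Num.Theory.
Import numFieldNormedType.Exports.

Set Implicit Arguments.
Unset Strict Implicit.
Unset Printing Implicit Defensive.

Local Open Scope classical_set_scope.
Local Open Scope ring_scope.

(* The complex plane is R * R.  The library norm of R * R is the sup norm, so
   the modulus is defined separately; the topology, the differential and local
   Lipschitz continuity are the same for both norms. *)
Definition cmod (R : realType) (z : R * R) : R :=
  Num.sqrt (z.1 ^+ 2 + z.2 ^+ 2).

Definition open_disk (R : realType) : set (R * R) := [set z | cmod z < 1].

Definition closed_disk (R : realType) : set (R * R) := [set z | cmod z <= 1].

Definition unit_circle (R : realType) : set (R * R) := [set z | cmod z = 1].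

(* f is a total function, but only its values on A matter. *)
Definition homeomorphism_on (T U : topologicalType) (A : set T) (B : set U)
    (f : T -> U) : Prop :=
  [/\ set_bij A B f, {within A, continuous f} &
      exists g : U -> T,
        {in A, cancel f g} /\ {within B, continuous g}].

(* [locally [lipschitz f x | x in A]] would ask for the Lipschitz estimate near
   every point (x, y) of A `*` A, including those with x != y. *)
Definition locally_lipschitz_on (R : realType) (V W : normedModType R)
    (A : set V) (f : V -> W) : Prop :=
  forall x, A x -> exists2 U, nbhs x U & [lipschitz f y | y in A `&` U].

(* The operator norm of the differential with respect to the modulus. At a point
   where h is not differentiable 'd h z is the zero map. *)
Definition diff_opnorm (R : realType) (h : R * R -> R * R) (z : R * R) : R :=
  sup [set cmod ('d h z v) | v in [set v | cmod v <= 1]].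

Definition lebesgue_measure2 (R : realType) :=
  ((@lebesgue_measure R) \x (@lebesgue_measure R))%E.

(* Main.v *)
(* Lift phi, composed with a reflection if it reverses the orientation, to an
   increasing f : R -> R with f (x + 1) = f x + 1, angles being measured in
   turns, and let r, x be the polar coordinates of z and
   y = 2 (1 - r).  The upper extension E+ of f averages f over [x, x + t] and
   then averages these means over the scales t = y, 2y, 4y, ..., truncated at
   1, with weights 3/4, 3/16, 3/64, ...; the lower extension E- does the same
   on the left of x.  Then
     h(z) = (1 - v) exp (2 pi i u),
     u = (E+ + E-)/2,  v = (E+ - E-)/2 + y/4.
   Since E+ + y/4 increases in x and in y while E- - y/4 increases in x and
   decreases in y, h is injective, and it is onto by the intermediate value
   theorem.  Near the origin E+ = x + c and E- = x + c - 1, so that h is z/2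
   up to a rotation.

   The average at scale t varies at most like the oscillation of f at scale t,
   which the averages at scale 2t control; as each scale weighs a fixed fraction
   of the previous one, this gives |Dh| <= C v/y = C (1 - |h|) / (1 - |z|).  With
   q = p (1 - beta) > p - 1 and q' = min (q, 1) the integrand is therefore at
   most C y^(q' - p) (1 + v/y).  On the shell y ~ 2^-n, covered by 2^n squares of
   side ~ 2^-n, the values of v telescope to a bounded sum, so the shell
   contributes at most C 2^(n (p - q' - 1)), and p - q' < 1. *)

Require Import Defs.
From mathcomp Require Import all_boot all_order all_algebra.
From mathcomp Require Import all_classical all_reals all_analysis.
From mathcomp Require Import measurable_realfun ring lra zify.
Import Order.TTheory GRing.Theory Num.Theory.
Import numFieldNormedType.Exports.

Set Implicit Arguments.
Unset Strict Implicit.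
Unset Printing Implicit Defensive.

Local Open Scope classical_set_scope.
Local Open Scope ring_scope.

(** * Means of a lift at dyadic scales and their weighted sum *)

(** Finitely many doublings bring any positive [y] above 2, so facts pass from coarse scales to fine
    ones along the recursion for [upper]. The threshold 2 leaves room: heights within [y / 4] of
    some [y >= 2] are still at least 1, where all averages are explicit. *)
Lemma dyadic_ind {R : realType} (P : R -> Prop) :
  (forall y, 2 <= y -> P y) -> (forall y, 0 < y -> P (2 * y) -> P y) ->
  forall y, 0 < y -> P y.
Proof.
move=> Pbig Pstep.
suff H n y : 0 < y -> 2 <= 2 ^+ n * y -> P y.
  move=> y y0; apply: (H (Num.truncn (2 / y)).+1) => //.
  rewrite -ler_pdivrMr //.
  have := truncnS_gt (2 / y) => /ltW /le_trans; apply.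
  by rewrite -natrX ler_nat ltnW // ltn_expl.
elim: n y => [|n IH] y y0; first by rewrite expr0 mul1r; exact: Pbig.
move=> hy; apply: Pstep => //; apply: IH; first by lra.
by rewrite mulrA -exprSr.
Qed.

(* The subgradient inequality, for b on both sides of a, is all that is used
   of [G' = f]; it also contains the monotonicity of f. *)
Record convex_primitive {R : realType} (f G : R -> R) (c : R) : Prop :=
  ConvexPrimitive {
    cp_subgradient : forall a b, f a * (b - a) <= G b - G a ;
    cp_fD1 : forall x, f (x + 1) = f x + 1 ;
    cp_GD1 : forall x, G (x + 1) = G x + x + c }.

Definition reflect_fun {R : realType} (f : R -> R) (x : R) : R := - f (- x).

(** This symmetry transfers each statement on [upper] to [lower]. The constant [1 - c] comes from
    [cp_GD1] at [- (x + 1)]. *)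
Lemma convex_primitive_reflect {R : realType} {f G : R -> R} {c : R} :
  convex_primitive f G c ->
  convex_primitive (reflect_fun f) (fun x => G (- x)) (1 - c).
Proof.
case=> sg fD GD; split=> [a b|x|x]; rewrite /reflect_fun.
- have := sg (- a) (- b); nra.
- by have := fD (- (x + 1)); rewrite (_ : - (x + 1) + 1 = - x); [lra|ring].
- by have := GD (- (x + 1)); rewrite (_ : - (x + 1) + 1 = - x); [lra|ring].
Qed.

(** The mean of [f] over an interval to the right of [x], written with the primitive so that
    estimates reduce to subgradient inequalities. At scale 1 it equals [x + c]. *)
Definition avg {R : realType} (G : R -> R) (x y : R) : R :=
  (G (x + Num.min y 1) - G x) / Num.min y 1.

(* The self-similarity [E x y = 3/4 avg x y + 1/4 E x (2 y)] defines the weighted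
   sum over all scales; once [1 <= 2 ^ n * y] the truncation in [avg] makes the
   value independent of n. *)
Fixpoint upper_rec {R : realType} (G : R -> R) (c : R) (n : nat) (x y : R) : R :=
  if n is m.+1 then 3 / 4 * avg G x y + 1 / 4 * upper_rec G c m x (2 * y)
  else x + c.

(** With [m] the number of steps, [1 / y < m <= 2 ^ m], so the recursion reaches a scale above 1. *)
Definition upper {R : realType} (G : R -> R) (c x y : R) : R :=
  upper_rec G c (Num.truncn y^-1).+1 x y.

Definition lower {R : realType} (G : R -> R) (c x y : R) : R :=
  - upper (fun t => G (- t)) (1 - c) (- x) y.

Definition width {R : realType} (G : R -> R) (c x y : R) : R :=
  upper G c x y - lower G c x y.

(** The right mean minus the left mean: the second summand is already the negative of the mean over
    the interval to the left of [x]. *)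
Definition avg_gap {R : realType} (G : R -> R) (x y : R) : R :=
  avg G x y + avg (fun t => G (- t)) (- x) y.

Section upper_extension.
Context {R : realType} {f G : R -> R} {c : R}.
Hypothesis cpG : convex_primitive f G c.
Let sg := cp_subgradient cpG.
Let fD1 := cp_fD1 cpG.
Let GD1 := cp_GD1 cpG.

Lemma cp_nondecreasing (x y : R) : x <= y -> f x <= f y.
Proof.
rewrite le_eqVlt => /predU1P[->//|xy].
by have := sg x y; have := sg y x; nra.
Qed.

Lemma min1_gt0 {y : R} : 0 < y -> 0 < Num.min y 1.
Proof. by move=> y0; rewrite lt_min y0 ltr01. Qed.

Lemma avg_ge1 (x y : R) : 1 <= y -> avg G x y = x + c.
Proof. by move=> y1; rewrite /avg min_r // divr1 GD1; ring. Qed.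

Lemma avg_min (x y : R) : 0 < y ->
  avg G x y * Num.min y 1 = G (x + Num.min y 1) - G x.
Proof. by move=> y0; rewrite /avg divfK // gt_eqF // min1_gt0. Qed.

Lemma avg_bounds (x y : R) : 0 < y -> f x <= avg G x y <= f (x + Num.min y 1).
Proof.
move=> y0; have := avg_min x y0; have := min1_gt0 y0.
set s := Num.min y 1 => s0 e.
by have := sg x (x + s); have := sg (x + s) x; nra.
Qed.

Lemma avgD1 (x y : R) : 0 < y -> avg G (x + 1) y = avg G x y + 1.
Proof.
move=> y0; have := min1_gt0 y0; rewrite /avg; set s := Num.min y 1 => s0.
rewrite (_ : x + 1 + s = x + s + 1); last by ring.
rewrite !GD1; field; lra.
Qed.

(** When the two intervals overlap, the common part cancels and the remaining pieces have equal
    length [x' - x]; otherwise the whole intervals are compared. Either way [f] is smaller on the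
    left piece. *)
Lemma avg_homo_x (x x' y : R) : 0 < y -> x <= x' -> avg G x y <= avg G x' y.
Proof.
move=> y0 xx'; have := avg_min x y0; have := avg_min x' y0.
have := min1_gt0 y0; set s := Num.min y 1 => s0 e' e.
rewrite -(ler_pM2r s0) e e'.
have [h|h] := leP x' (x + s).
  have := sg (x + s) (x' + s); have := sg x' x.
  have := cp_nondecreasing h; nra.
have := sg x' (x' + s); have := sg (x + s) x.
have := cp_nondecreasing (ltW h); nra.
Qed.

(** With [s <= t] the truncated scales, [B - A] is [(t - s) / t] times the mean over
    [[x + s, x + t]] minus the mean over [[x, x + s]]. Both means lie between [f x] and
    [f (x + t)]. *)
Lemma avg_increment (x y y' : R) : 0 < y -> y <= y' ->
  0 <= avg G x y' - avg G x y <=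
  (Num.min y' 1 - Num.min y 1) / Num.min y' 1 * (f (x + Num.min y' 1) - f x).
Proof.
move=> y0 yy'; have y'0 := lt_le_trans y0 yy'.
have := avg_min x y0; have := avg_min x y'0.
have := min1_gt0 y0; have := min1_gt0 y'0.
have : Num.min y 1 <= Num.min y' 1 by rewrite le_min2.
set s := Num.min y 1; set t := Num.min y' 1 => st t0 s0 et es.
have h1 := sg (x + s) (x + t); have h2 := sg (x + s) x.
have h3 := sg (x + t) (x + s); have h4 := sg x (x + s).
set A := avg G x y in es *; set B := avg G x y' in et *.
have e : s * t * (B - A) = s * (G (x + t) - G (x + s)) - (t - s) * (G (x + s) - G x).
  by rewrite -[G (x + t)](subrK (G x)) -et -[G (x + s)](subrK (G x)) -es; ring.
have st0 : 0 < s * t by rewrite mulr_gt0.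
apply/andP; split.
  rewrite -(pmulr_rge0 _ st0) e; nra.
rewrite -(ler_pM2l st0) e.
rewrite (_ : s * t * _ = s * (t - s) * (f (x + t) - f x)); last by field; lra.
nra.
Qed.

Lemma avg_homo_y (x y y' : R) : 0 < y -> y <= y' -> avg G x y <= avg G x y'.
Proof. by move=> y0 /(avg_increment x y0) /andP[+ _]; rewrite subr_ge0. Qed.

Lemma upper_rec_ge1 n (x y : R) : 1 <= y -> upper_rec G c n x y = x + c.
Proof.
elim: n y => // n IH y y1; rewrite /= IH ?avg_ge1 //; [by field|lra].
Qed.

Lemma upper_recS n (x y : R) :
  1 <= 2 ^+ n * y -> upper_rec G c n.+1 x y = upper_rec G c n x y.
Proof.
elim: n y => [|n IH] y.
  by rewrite expr0 mul1r => y1; rewrite upper_rec_ge1.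
by rewrite exprSr -mulrA => /IH; rewrite /= => ->.
Qed.

Lemma upper_rec_stable n (x y : R) : 0 < y ->
  1 <= 2 ^+ n * y -> upper G c x y = upper_rec G c n x y.
Proof.
have H k m z : 0 < z -> 1 <= 2 ^+ k * z -> (k <= m)%N ->
    upper_rec G c m x z = upper_rec G c k x z.
  move=> z0 kz; elim: m => [|m IH]; first by rewrite leqn0 => /eqP ->.
  rewrite leq_eqVlt => /predU1P[->//|]; rewrite ltnS => km.
  rewrite upper_recS ?IH // (le_trans kz) // ler_pM2r //.
  by rewrite ler_eXn2l // ltr1n.
move=> y0 ny; rewrite /upper; set m := _.+1.
have my : 1 <= 2 ^+ m * y.
  rewrite -ler_pdivrMr // div1r.
  have := truncnS_gt y^-1 => /ltW /le_trans; apply.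
  by rewrite -natrX ler_nat ltnW // ltn_expl.
by case: (leqP n m) => [h|/ltnW h]; [apply: H|rewrite -(H _ n)].
Qed.

Lemma upper_ge1 (x y : R) : 1 <= y -> upper G c x y = x + c.
Proof. by move=> y1; rewrite /upper upper_rec_ge1. Qed.

Lemma upper_step (x y : R) : 0 < y ->
  upper G c x y = 3 / 4 * avg G x y + 1 / 4 * upper G c x (2 * y).
Proof.
move=> y0; set m := (Num.truncn y^-1).+1.
have my : 1 <= 2 ^+ m * y.
  rewrite -ler_pdivrMr // div1r.
  have := truncnS_gt y^-1 => /ltW /le_trans; apply.
  by rewrite -natrX ler_nat ltnW // ltn_expl.
rewrite (@upper_rec_stable m.+1) //; last first.
  by rewrite exprS -mulrA; lra.
by rewrite /= (@upper_rec_stable m x (2 * y)) //; lra.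
Qed.

Lemma upper_bounds (x y : R) : 0 < y -> f x <= upper G c x y <= f x + 1.
Proof.
have avgb z : 0 < z -> f x <= avg G x z <= f x + 1.
  move=> /(avg_bounds x) /andP[-> /le_trans]; apply.
  by rewrite -fD1 cp_nondecreasing // lerD2l ge_min lexx orbT.
move: y; apply: dyadic_ind => [y y2|y y0 IH].
  have y1 : 1 <= y by lra.
  by rewrite upper_ge1 // -(avg_ge1 _ y1) avgb //; lra.
by rewrite upper_step //; have := avgb y y0; lra.
Qed.

Lemma upperD1 (x y : R) : 0 < y -> upper G c (x + 1) y = upper G c x y + 1.
Proof.
move: y; apply: dyadic_ind => [y y2|y y0 IH].
  by rewrite !upper_ge1; lra.
by rewrite !(@upper_step _ y) // avgD1 // IH; lra.
Qed.

(** The means increase only weakly; strictness comes from the scales above 1, whose contribution is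
    a positive multiple of [x + c]. *)
Lemma upper_lt_x (x x' y : R) : 0 < y -> x < x' -> upper G c x y < upper G c x' y.
Proof.
move=> + xx'; move: y; apply: dyadic_ind => [y y2|y y0 IH].
  by rewrite !upper_ge1; lra.
by rewrite !(@upper_step _ y) //; have := avg_homo_x y0 (ltW xx'); lra.
Qed.

Lemma upper_homo_x (x x' y : R) : 0 < y -> x <= x' -> upper G c x y <= upper G c x' y.
Proof.
by move=> y0; rewrite le_eqVlt => /predU1P[->//|/(upper_lt_x y0)/ltW].
Qed.

Lemma upper_homo_y (x y y' : R) : 0 < y -> y <= y' -> upper G c x y <= upper G c x y'.
Proof.
move=> y0; move: y y0 y'; apply: dyadic_ind => [y y2|y y0 IH] y' yy'.
  by rewrite !upper_ge1; lra.
have y'0 := lt_le_trans y0 yy'.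
rewrite (upper_step x y0) (upper_step x y'0).
have := avg_homo_y x y0 yy'.
have : upper G c x (2 * y) <= upper G c x (2 * y') by apply: IH; lra.
lra.
Qed.

(** The first [m] scales average over subintervals of [[x, x + d]]. The coarser ones have total
    weight [(1 / 4) ^ m] and exceed [f x] by at most 1. *)
Lemma upper_near_boundary (x d y : R) m : 0 < y -> d <= 1 -> 2 ^+ m * y <= d ->
  upper G c x y <= f (x + d) + (1 / 4) ^+ m.
Proof.
move=> + d1; elim: m y => [|m IH] y y0.
  rewrite expr0 mul1r => yd; have /andP[_ /le_trans] := upper_bounds x y0.
  by apply; rewrite expr0 lerD2r cp_nondecreasing // lerDl; lra.
rewrite exprSr -mulrA => md; rewrite upper_step // exprS.
have IHy : upper G c x (2 * y) <= f (x + d) + (1 / 4) ^+ m by apply: IH => //; lra.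
have /andP[_] := avg_bounds x y0.
have yd : y <= d.
  apply: le_trans md.
  have : 1 <= 2 ^+ m :> R by apply: exprn_ege1; lra.
  nra.
have : f (x + Num.min y 1) <= f (x + d).
  by rewrite cp_nondecreasing // lerD2l ge_min yd.
lra.
Qed.

(** First [x] moves at height [y], then the height moves at [x0]. All points met stay within
    [y0 / 4 + 5 / 4 * y0 = 3 / 2 * y0] of [x0], so the oscillation [O] controls every difference of
    values of [f]. *)
Lemma avg_lipschitz (x0 y0 x y : R) : 0 < y0 -> y0 <= 4 / 3 ->
  `|x - x0| <= y0 / 4 -> `|y - y0| <= y0 / 4 ->
  `|avg G x y - avg G x0 y0| <=
  2 * (f (x0 + 3 / 2 * y0) - f (x0 - 3 / 2 * y0)) *
  (`|x - x0| / Num.min y0 1 + `|y - y0| / y0).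
Proof.
move=> y00 y043 hx hy.
have xb := hx; rewrite ler_norml in xb; have yb := hy; rewrite ler_norml in yb.
have yp : 0 < y by lra.
set O := f (x0 + _) - f (x0 - _).
have s00 := min1_gt0 y00.
have O_ge p q : x0 - 3 / 2 * y0 <= p -> q <= x0 + 3 / 2 * y0 -> f q - f p <= O.
  by move=> /cp_nondecreasing ? /cp_nondecreasing ?; rewrite /O; lra.
have O0 : 0 <= O by have := O_ge x0 x0; rewrite subrr; apply; lra.
move: O O_ge O0 => O O_ge O0.
have sy : Num.min y 1 <= y by rewrite ge_min lexx.
have sp := min1_gt0 yp.
have s34 : 3 / 4 * Num.min y0 1 <= Num.min y 1.
  rewrite le_min; have : Num.min y0 1 <= y0 by rewrite ge_min lexx.
  have : Num.min y0 1 <= 1 by rewrite ge_min lexx orbT.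
  by move=> ? ?; apply/andP; split; lra.
have H1 : `|avg G x y - avg G x0 y| <= 2 * O * (`|x - x0| / Num.min y0 1).
  have hs : `|avg G x y - avg G x0 y| * Num.min y 1 <= `|x - x0| * O.
    rewrite -[Num.min y 1]gtr0_norm // -normrM mulrBl !avg_min //.
    set s := Num.min y 1 in sp sy *.
    have a1 := sg (x0 + s) (x + s); have a2 := sg (x + s) (x0 + s).
    have a3 := sg x x0; have a4 := sg x0 x.
    have b1 : f (x + s) - f x0 <= O by apply: O_ge; lra.
    have b2 : f (x0 + s) - f x <= O by apply: O_ge; lra.
    have b3 : f x0 <= f (x0 + s) by apply: cp_nondecreasing; lra.
    have b4 : f x <= f (x + s) by apply: cp_nondecreasing; lra.
    rewrite ler_norml; case: (lerP x0 x) => xx0.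
      have [e1 e2] : f (x + s) - f x0 <= O /\ - O <= f (x0 + s) - f x.
        split => //; have : f x - f (x0 + s) <= O by apply: O_ge; lra.
        lra.
      by apply/andP; split; nra.
    have [e1 e2] : f (x0 + s) - f x <= O /\ - O <= f (x + s) - f x0.
      split => //; have : f x0 - f (x + s) <= O by apply: O_ge; lra.
      lra.
    by apply/andP; split; nra.
  rewrite -(ler_pM2r sp); apply: le_trans hs _.
  rewrite (_ : _ * Num.min y 1 =
    `|x - x0| * O * (2 * Num.min y 1 / Num.min y0 1)); last first.
    by field; lra.
  rewrite ler_peMr ?mulr_ge0 // ler_pdivlMr // mul1r; lra.
have H2 : `|avg G x0 y - avg G x0 y0| <= 2 * O * (`|y - y0| / y0).
  have key u v : 0 < u -> u <= v -> y0 <= v -> v <= 5 / 4 * y0 ->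
      `|avg G x0 v - avg G x0 u| <= 2 * O * ((v - u) / y0).
    move=> u0 uv y0v vy; have v0 := lt_le_trans u0 uv.
    have /andP[h0 h1] := avg_increment x0 u0 uv.
    rewrite ger0_norm //; apply: le_trans h1 _.
    have mv : Num.min v 1 <= v by rewrite ge_min lexx.
    have mv0 := min1_gt0 v0.
    have fO : f (x0 + Num.min v 1) - f x0 <= O by apply: O_ge; lra.
    have f0 : 0 <= f (x0 + Num.min v 1) - f x0.
      by rewrite subr_ge0 cp_nondecreasing //; lra.
    have d1 : 0 <= Num.min v 1 - Num.min u 1 <= v - u.
      by rewrite !minEle; do 2 case: ifP => ?; lra.
    (* The hypothesis [y0 <= 4 / 3] enters here: truncation at 1 keeps at least [3 / 4 * y0]. *)
    have d2 : 3 / 4 * y0 <= Num.min v 1.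
      by rewrite le_min; apply/andP; split; lra.
    rewrite mulrAC ler_pdivrMr //.
    apply: (@le_trans _ _ ((v - u) * O)).
      by case/andP: d1 => d1 d1'; rewrite ler_pM.
    rewrite (_ : 2 * O * _ * _ = (v - u) * O * (2 * Num.min v 1 / y0)); last first.
      by field; lra.
    have vuO : 0 <= (v - u) * O by rewrite mulr_ge0 // subr_ge0.
    apply: (ler_peMr vuO); rewrite ler_pdivlMr // mul1r.
    by lra.
  case: (leP y0 y) => yy.
    rewrite [`|y - y0|]ger0_norm; last by lra.
    by apply: key; lra.
  rewrite distrC [`|y - y0|]ler0_norm; last by lra.
  by rewrite opprB; apply: key; lra.
rewrite mulrDr; apply: le_trans (lerD H1 H2).
rewrite (_ : _ - avg G x0 y0 = avg G x y - avg G x0 y + (avg G x0 y - avg G x0 y0)).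
  exact: ler_normD.
by ring.
Qed.
End upper_extension.

(** On the last quarter of [[x, x + 2 * y]] the values are at least [f (x + 3 / 2 * y)], and at
    least [f x] on the rest, so the mean exceeds [f x] by a quarter of the oscillation. The bound on
    [y] excludes truncation. *)
Lemma avg_osc {R : realType} (f G : R -> R) c (x y : R) :
  convex_primitive f G c -> 0 < y -> y <= 1 / 2 ->
  f (x + 3 / 2 * y) - f x <= 4 * (avg G x (2 * y) - f x).
Proof.
move=> cp y0 y2; have y20 : 0 < 2 * y by lra.
have := @avg_min _ G x _ y20; rewrite min_l; last by lra.
have := cp_subgradient cp (x + 3 / 2 * y) (x + 2 * y).
have := cp_subgradient cp x (x + 3 / 2 * y).
move: (f (x + _)) (f x) (avg G x _) => a b m h1 h2 h3.
suff : y * (a - b) <= y * (4 * (m - b)) by rewrite ler_pM2l.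
nra.
Qed.

Lemma width_reflect {R : realType} (G : R -> R) c x y :
  width (fun t : R => G (- t)) (1 - c) (- x) y = width G c x y.
Proof.
rewrite /width /lower !opprK addrC; congr (_ + _).
rewrite (_ : (fun t => _) = G); last by apply/funext => t; rewrite opprK.
by rewrite opprB addrCA subrr addr0.
Qed.

(** * The width between the two extensions controls their variation *)

Section width_estimates.
Context {R : realType} {f G : R -> R} {c : R}.
Hypothesis cpG : convex_primitive f G c.
Let cpG' := convex_primitive_reflect cpG.

Lemma avg_gap_ge1 (x y : R) : 1 <= y -> avg_gap G x y = 1.
Proof. by move=> y1; rewrite /avg_gap (avg_ge1 cpG) // (avg_ge1 cpG') //; ring. Qed.

Lemma avg_gap_ge0 (x y : R) : 0 < y -> 0 <= avg_gap G x y.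
Proof.
move=> y0; have /andP[h _] := avg_bounds cpG x y0.
have /andP[h' _] := avg_bounds cpG' (- x) y0.
by rewrite /reflect_fun opprK in h'; rewrite /avg_gap; lra.
Qed.

Lemma osc_le_avg_gap (x y : R) : 0 < y -> y <= 4 / 3 ->
  f (x + 3 / 2 * y) - f (x - 3 / 2 * y) <= 4 * avg_gap G x (2 * y).
Proof.
move=> y0 y43; case: (leP y (1 / 2)) => y2.
  have := avg_osc x cpG y0 y2; have := avg_osc (- x) cpG' y0 y2.
  rewrite /avg_gap /reflect_fun !opprK.
  by rewrite (_ : - (- x + 3 / 2 * y) = x - 3 / 2 * y); [lra|ring].
(* At these heights the gap is 1, and [3 / 2 * y <= 2] bounds the oscillation by
   [f (x + 2) - f (x - 2) = 4]. *)
rewrite avg_gap_ge1; last by lra.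
have fD := cp_fD1 cpG.
have : f (x + 3 / 2 * y) <= f (x + 1 + 1) by apply: (cp_nondecreasing cpG); lra.
have : f (x - 1 - 1) <= f (x - 3 / 2 * y) by apply: (cp_nondecreasing cpG); lra.
have := fD (x + 1); have := fD x; have := fD (x - 1); have := fD (x - 1 - 1).
by rewrite !subrK; lra.
Qed.

Lemma avg_lipschitz_gap (x0 y0 x y : R) : 0 < y0 ->
  `|x - x0| <= y0 / 4 -> `|y - y0| <= y0 / 4 ->
  `|avg G x y - avg G x0 y0| <= 8 * avg_gap G x0 (2 * y0) *
  (`|x - x0| / Num.min y0 1 + `|y - y0| / y0).
Proof.
move=> y00 hx hy.
have mp := min1_gt0 y00.
have d0 : 0 <= `|x - x0| / Num.min y0 1 + `|y - y0| / y0.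
  by rewrite addr_ge0 ?divr_ge0 // ltW.
case: (leP y0 (4 / 3)) => y43.
  apply: le_trans (avg_lipschitz cpG y00 y43 hx hy) _.
  apply: ler_wpM2r => //.
  by have := osc_le_avg_gap x0 y00 y43; lra.
have yb := hy; rewrite ler_norml in yb.
(* Above [4 / 3] both heights are at least 1, where the averages are translations. *)
have y1 : 1 <= y by lra.
have y01 : 1 <= y0 by lra.
rewrite !(avg_ge1 cpG) // avg_gap_ge1 ?min_r //; last by lra.
rewrite divr1 (_ : x + c - _ = x - x0); last by ring.
have : 0 <= `|y - y0| / y0 by rewrite divr_ge0 // ltW.
by have := normr_ge0 (x - x0); lra.
Qed.

Lemma width_ge1 (x y : R) : 1 <= y -> width G c x y = 1.
Proof.
by move=> y1; rewrite /width /lower (upper_ge1 cpG) // (upper_ge1 cpG') //; ring.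
Qed.

Lemma width_step (x y : R) : 0 < y ->
  width G c x y = 3 / 4 * avg_gap G x y + 1 / 4 * width G c x (2 * y).
Proof.
move=> y0; rewrite /width /lower (upper_step cpG x y0) (upper_step cpG' (- x) y0).
by rewrite /avg_gap; ring.
Qed.

Lemma width_ge0 (x y : R) : 0 < y -> 0 <= width G c x y.
Proof.
move: y; apply: dyadic_ind => [y y2|y y0 IH]; first by rewrite width_ge1; lra.
by rewrite width_step //; have := avg_gap_ge0 x y0; lra.
Qed.

Lemma width_double_le (x y : R) : 0 < y -> width G c x (2 * y) <= 4 * width G c x y.
Proof. by move=> y0; rewrite (width_step x y0); have := avg_gap_ge0 x y0; lra. Qed.

Lemma upper_lipschitz (x0 y0 x y : R) : 0 < y0 ->
  `|x - x0| <= y0 / 4 -> `|y - y0| <= y0 / 4 ->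
  `|upper G c x y - upper G c x0 y0| <= 32 * width G c x0 y0 *
  (`|x - x0| / Num.min y0 1 + `|y - y0| / y0).
Proof.
move=> y00 hx hy.
have mp := min1_gt0 y00.
have d0 : 0 <= `|x - x0| / Num.min y0 1 + `|y - y0| / y0.
  by rewrite addr_ge0 ?divr_ge0 // ltW.
(* The shift to scale 2 y0 lets the bound pass through the recursion for the
   weighted sum without loss. *)
suff H : `|upper G c x y - upper G c x0 y0| <= 8 * width G c x0 (2 * y0) *
    (`|x - x0| / Num.min y0 1 + `|y - y0| / y0).
  apply: le_trans H _; apply: ler_wpM2r => //.
  by have := width_double_le x0 y00; lra.
move: y00 y hx hy {mp d0}; move: y0; apply: dyadic_ind => [y0 y02|y0 y00 IH] y hx hy.
  have yb := hy; rewrite ler_norml in yb.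
  rewrite !(upper_ge1 cpG) ?width_ge1 ?min_r; try lra.
  rewrite divr1 (_ : x + c - _ = x - x0); last by ring.
  have : 0 <= `|y - y0| / y0 by rewrite divr_ge0 //; lra.
  by have := normr_ge0 (x - x0); lra.
have yb := hy; rewrite ler_norml in yb.
have y0' : 0 < y by lra.
have y20 : 0 < 2 * y0 by lra.
have hy2 : `|2 * y - 2 * y0| = 2 * `|y - y0|.
  by rewrite -mulrBr normrM ger0_norm.
have mp := min1_gt0 y00.
have h := avg_lipschitz_gap y00 hx hy.
have h2 : `|upper G c x (2 * y) - upper G c x0 (2 * y0)| <=
    8 * width G c x0 (2 * (2 * y0)) * (`|x - x0| / Num.min y0 1 + `|y - y0| / y0).
  apply: le_trans (IH (2 * y) _ _) _; [lra|rewrite hy2; lra|].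
  apply: ler_wpM2l.
    by rewrite mulr_ge0 // width_ge0 //; lra.
  (* Doubling the heights does not increase the horizontal ratio and leaves the vertical one
     unchanged. *)
  apply: lerD.
    apply: ler_wpM2l => //; rewrite lef_pV2 ?posrE ?min1_gt0 //.
    by rewrite le_min2 //; lra.
  by rewrite hy2 -mulf_div divff ?mul1r.
rewrite (upper_step cpG x y0') (upper_step cpG x0 y00) (width_step x0 y20).
rewrite (_ : 3 / 4 * avg G x y + _ - _ = 3 / 4 * (avg G x y - avg G x0 y0) +
  1 / 4 * (upper G c x (2 * y) - upper G c x0 (2 * y0))); last by ring.
apply: le_trans (ler_normD _ _) _; rewrite (normrM (3 / 4)) (normrM (1 / 4)).
rewrite (@ger0_norm _ (3 / 4)) ?(@ger0_norm _ (1 / 4)); [|lra|lra].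
by move: h h2; set A := avg_gap _ _ _; set W := width _ _ _ _; set d := _ + _; lra.
Qed.

Lemma lower_bounds (x y : R) : 0 < y -> f x - 1 <= lower G c x y <= f x.
Proof.
move=> y0; have := upper_bounds cpG' (- x) y0.
by rewrite /lower /reflect_fun opprK; lra.
Qed.

Lemma lower_ge1 (x y : R) : 1 <= y -> lower G c x y = x + c - 1.
Proof. by move=> y1; rewrite /lower (upper_ge1 cpG') //; ring. Qed.

Lemma lowerD1 (x y : R) : 0 < y -> lower G c (x + 1) y = lower G c x y + 1.
Proof.
move=> y0; have := upperD1 cpG' (- (x + 1)) y0.
by rewrite /lower (_ : - (x + 1) + 1 = - x) => [->|]; ring.
Qed.

Lemma lower_lt_x (x x' y : R) : 0 < y -> x < x' -> lower G c x y < lower G c x' y.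
Proof. by move=> y0 xx'; rewrite /lower ltrN2 (upper_lt_x cpG') // ltrN2. Qed.

Lemma lower_homo_x (x x' y : R) : 0 < y -> x <= x' -> lower G c x y <= lower G c x' y.
Proof. by move=> y0 xx'; rewrite /lower lerN2 (upper_homo_x cpG') // lerN2. Qed.

Lemma lower_nhomo_y (x y y' : R) : 0 < y -> y <= y' -> lower G c x y' <= lower G c x y.
Proof. by move=> y0 yy'; rewrite /lower lerN2 (upper_homo_y cpG'). Qed.

Lemma lower_near_boundary (x d y : R) m : 0 < y -> d <= 1 -> 2 ^+ m * y <= d ->
  f (x - d) - (1 / 4) ^+ m <= lower G c x y.
Proof.
move=> y0 d1 h; have := upper_near_boundary cpG' (- x) y0 d1 h.
rewrite /lower /reflect_fun (_ : - (- x + d) = x - d); [lra|ring].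
Qed.
End width_estimates.

Lemma lower_lipschitz {R : realType} {f G : R -> R} {c : R}
  (cpG : convex_primitive f G c) (x0 y0 x y : R) : 0 < y0 ->
  `|x - x0| <= y0 / 4 -> `|y - y0| <= y0 / 4 ->
  `|lower G c x y - lower G c x0 y0| <= 32 * width G c x0 y0 *
  (`|x - x0| / Num.min y0 1 + `|y - y0| / y0).
Proof.
have xE : `|- x - - x0| = `|x - x0| by rewrite -opprD normrN.
move=> y00; rewrite -xE => hx hy.
have := upper_lipschitz (convex_primitive_reflect cpG) y00 hx hy.
rewrite width_reflect distrC => h; apply: le_trans h.
by rewrite /lower opprK addrC.
Qed.

(** * Widths summed over one dyadic level *)

Lemma sum_half {R : realType} (T : nat -> R) (N : nat) :
  \sum_(0 <= j < N.*2) T j./2 = 2 * \sum_(0 <= j < N) T j.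
Proof.
elim: N => [|N IH]; first by rewrite !big_geq // mulr0.
rewrite doubleS !big_nat_recr //= IH uphalf_double doubleK; ring.
Qed.

(* [S_(n+1) <= 9/4 + 2 * (1/4) * S_n]: the finest scale telescopes, and each
   coarser interval is counted twice with weight 1/4. *)
Lemma width_sum {R : realType} (f G : R -> R) (c : R) n :
  convex_primitive f G c ->
  \sum_(0 <= j < (2 ^ n)%N) (upper G c (j.+1%:R / 2 ^+ n) (2 ^+ n)^-1 -
    lower G c (j%:R / 2 ^+ n) (2 ^+ n)^-1) <= 9 / 2.
Proof.
move=> cp; elim: n => [|n IH].
  rewrite expn0 big_nat1 expr0 invr1 !mulr1 (upper_ge1 cp) ?(lower_ge1 cp) //.
  lra.
set N := (2 ^ n.+1)%N; set y : R := (2 ^+ n.+1)^-1.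
have yp : 0 < y by rewrite invr_gt0 exprn_gt0.
have y1 : y <= 1 by rewrite invf_le1 ?exprn_gt0 // exprn_ege1 //; lra.
have y2 : 2 * y = (2 ^+ n)^-1.
  by rewrite /y exprS invfM mulrA divff ?mul1r.
have Ny : N%:R * y = 1 by rewrite /N /y natrX divff // expf_neq0.
have cp' := convex_primitive_reflect cp.
pose F j : R := f (j%:R * y).
pose T j := upper G c (j.+1%:R / 2 ^+ n) (2 ^+ n)^-1 -
    lower G c (j%:R / 2 ^+ n) (2 ^+ n)^-1.
have FN j : F (j + N)%N = F j + 1.
  by rewrite /F natrD mulrDl Ny (cp_fD1 cp).
have shift j : \sum_(0 <= i < N) (F (i + j).+1 - F (i + j)%N) = 1.
  rewrite (telescope_sumr (fun i => F (i + j)%N)) // add0n addnC FN.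
  by rewrite addrAC subrr add0r.
(* [H j + (F' j.+1 - F' j)] is the increment of [f] over three neighbouring intervals of length [y].
   Each of the three sums over a period is 1, which gives [3 / 4 * 3 = 9 / 4]. [F'] stands for [F]
   at [j - 1], which makes sense also for [j = 0]. *)
pose H j := (F (j + 1).+1 - F (j + 1)%N) + (F (j + 0).+1 - F (j + 0)%N).
pose F' j : R := f (j%:R * y - y).
have shift' : \sum_(0 <= i < N) (F' i.+1 - F' i) = 1.
  rewrite telescope_sumr // /F' Ny mul0r.
  by rewrite (_ : 1 - y = 0 - y + 1) ?(cp_fD1 cp); [lra|ring].
apply: (@le_trans _ _ (\sum_(0 <= j < N) (3 / 4 * (H j + (F' j.+1 - F' j)) +
    1 / 4 * T j./2))); last first.
  rewrite big_split /= -!mulr_sumr big_split /= shift' /H big_split /= !shift.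
  rewrite /N expnS mul2n sum_half.
  by move: IH; rewrite -/T; set S := \sum_(_ <= _ < _) _; lra.
rewrite big_nat_cond [X in _ <= X]big_nat_cond; apply: ler_sum => j _.
rewrite /lower (upper_step cp) // (upper_step cp') // y2.
have h1 : avg G (j.+1%:R / 2 ^+ n.+1) y <= F (j + 1).+1.
  have /andP[_ /le_trans] := avg_bounds cp (j.+1%:R / 2 ^+ n.+1) yp; apply.
  rewrite min_l // /F addn1 -/y; apply: (cp_nondecreasing cp).
  by rewrite -[in X in _ <= X]natr1 mulrDl mul1r.
have h2 : avg (fun t => G (- t)) (- (j%:R / 2 ^+ n.+1)) y <= - F' j.
  have /andP[_ /le_trans] := avg_bounds cp' (- (j%:R / 2 ^+ n.+1)) yp; apply.
  rewrite min_l // /reflect_fun /F' lerN2 -/y.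
  by rewrite (_ : - (- (j%:R * y) + y) = j%:R * y - y) //; ring.
(* The [j]-th interval of the finer level lies in the interval [j./2] of the coarser one. *)
have jE : (j = odd j + j./2.*2)%N by rewrite odd_double_half.
have jn b : (b + j./2.*2)%:R / 2 ^+ n.+1 = j./2%:R / 2 ^+ n + b%:R * y :> R.
  rewrite natrD mulrDl addrC; congr (_ + _).
  by rewrite -mul2n natrM exprS -mulf_div divff ?mul1r.
have h3 : upper G c (j.+1%:R / 2 ^+ n.+1) (2 ^+ n)^-1 <=
    upper G c (j./2.+1%:R / 2 ^+ n) (2 ^+ n)^-1.
  apply: (upper_homo_x cp); first by rewrite invr_gt0 exprn_gt0.
  rewrite -[j./2.+1%:R]natr1 mulrDl mul1r {1}jE -addSn jn lerD2l -y2.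
  by rewrite ler_pM2r // ler_nat; case: odd.
have h4 : upper (fun t => G (- t)) (1 - c) (- (j%:R / 2 ^+ n.+1)) (2 ^+ n)^-1 <=
    upper (fun t => G (- t)) (1 - c) (- (j./2%:R / 2 ^+ n)) (2 ^+ n)^-1.
  apply: (upper_homo_x cp'); first by rewrite invr_gt0 exprn_gt0.
  rewrite lerN2 {2}jE jn lerDl mulr_ge0 // ltW //.
have h5 : H j + (F' j.+1 - F' j) = F (j + 1).+1 - F' j.
  rewrite /H addn0 addn1 /F' /F.
  rewrite (_ : j.+1%:R * y - y = j%:R * y); [ring|].
  by rewrite -natr1; ring.
by rewrite h5 /T /lower; lra.
Qed.

(** * Convex primitives of continuous monotone functions *)

Section primitive.
Context {R : realType}.
Implicit Types f : R -> R.
Let mu : measure _ _ := @lebesgue_measure R.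

Lemma Rintegral_itv_bounds f (a b : R) : {homo f : x y / x <= y} ->
  continuous f -> 0 <= a -> a <= b ->
  f a * (b - a) <= \int[mu]_(t in `[0, b]) f t - \int[mu]_(t in `[0, a]) f t
    <= f b * (b - a).
Proof.
move=> fh fc a0 ab.
have int (g : R -> R) p q : continuous g -> mu.-integrable `[p, q] (EFin \o g).
  move=> gc; apply: continuous_compact_integrable; first exact: segment_compact.
  exact: continuous_subspaceT.
have into (g : R -> R) : continuous g -> mu.-integrable `]a, b] (EFin \o g).
  move=> /(@int _ a b); apply: integrableS => //.
  by apply: subset_itvr; rewrite bnd_simp.
have cint k : mu.-integrable `]a, b] (EFin \o cst k).
  by apply: into => ?; exact: cst_continuous.
have muab : fine (mu `]a, b]%classic) = b - a.
  have -> : mu `]a, b]%classic = (if (a%:E < b%:E)%E then b%:E - a%:E else 0)%E.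
    exact: (lebesgue_measure_itv `]a, b]).
  rewrite /= lte_fin; case: ltP => //= ba.
  by apply/esym/eqP; rewrite subr_eq0 eq_le ab ba.
have := into f fc; have := int f 0 b fc => i1 i2.
rewrite Rintegral_itvB //.
apply/andP; split.
  rewrite -muab -Rintegral_cst //; apply: le_Rintegral => //; first exact: cint (f a).
  by move=> t; rewrite /= in_itv /= => /andP[/ltW /fh].
rewrite -muab -Rintegral_cst //; apply: le_Rintegral => //; first exact: cint (f b).
by move=> t; rewrite /= in_itv /= => /andP[_ /fh].
Qed.

Lemma reflect_homo f : {homo f : x y / x <= y} -> {homo reflect_fun f : x y / x <= y}.
Proof. by move=> fh x y xy; rewrite /reflect_fun lerN2 fh // lerN2. Qed.

Lemma reflect_continuous f : continuous f -> continuous (reflect_fun f).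
Proof.
move=> fc x; apply: continuousN; apply: (@continuous_comp _ _ _ (@GRing.opp R)).
  exact: opp_continuous.
exact: fc.
Qed.

Lemma exists_subgradient f : {homo f : x y / x <= y} -> continuous f ->
  exists G : R -> R, forall a b, f a * (b - a) <= G b - G a.
Proof.
move=> fh fc.
pose P (g : R -> R) x := \int[mu]_(t in `[0, x]) g t.
have P0 g : P g 0 = 0 by rewrite /P set_itv1 Rintegral_set1.
(* For negative [x] a reflection turns the integral from 0 down to [x] into one over [[0, - x]], so
   one estimate serves both half-lines. *)
pose G x := if 0 <= x then P f x else P (reflect_fun f) (- x).
have Gpos a b : 0 <= a -> a <= b -> f a * (b - a) <= G b - G a <= f b * (b - a).
  move=> a0 ab; rewrite /G a0 (le_trans a0 ab); exact: Rintegral_itv_bounds.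
have Gneg a b : a <= b -> b <= 0 -> f a * (b - a) <= G b - G a <= f b * (b - a).
  move=> ab b0; have GN x : x <= 0 -> G x = P (reflect_fun f) (- x).
    rewrite /G; case: (ltgtP x 0) => // -> _; by rewrite oppr0 !P0.
  rewrite !GN // ?(le_trans ab) //.
  have := Rintegral_itv_bounds (reflect_homo fh) (reflect_continuous fc)
    (_ : 0 <= - b) (_ : - b <= - a).
  rewrite -/(P _ _) -/(P _ _) lerN2 oppr_ge0 => /(_ b0 ab).
  by rewrite /reflect_fun !opprK; lra.
have GG a b : a <= b -> f a * (b - a) <= G b - G a <= f b * (b - a).
  move=> ab; case: (leP 0 a) => a0; first exact: Gpos.
  case: (leP b 0) => b0; first exact: Gneg.
  have := Gneg a 0 (ltW a0) (lexx _); have := Gpos 0 b (lexx _) (ltW b0).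
  by have := fh _ _ (ltW a0); have := fh _ _ (ltW b0); nra.
exists G => a b; case: (leP a b) => [/GG/andP[]//|/ltW/GG].
by lra.
Qed.

(* Subdividing [a, b] into n equal parts bounds [D b - D a] by 1/n times a
   constant. *)
Lemma sub_increment_cst (D f : R -> R) : {homo f : x y / x <= y} ->
  (forall a b, a <= b -> `|D b - D a| <= (b - a) * (f b - f a)) ->
  forall a b, D a = D b.
Proof.
move=> fh DD.
suff H a b : a <= b -> D a = D b by move=> a b; case: (leP a b) => [/H|/ltW/H].
move=> ab; apply/eqP; rewrite eq_sym -subr_eq0 -normr_le0 leNgt; apply/negP => D0.
pose K := (b - a) * (f b - f a).
have K0 : 0 <= K by rewrite mulr_ge0 // subr_ge0 // fh.
pose n := (Num.truncn (K / `|D b - D a|)).+1.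
have nK : K < n%:R * `|D b - D a| by rewrite -ltr_pdivrMr // truncnS_gt.
have n0 : 0 < n%:R :> R by rewrite ltr0n.
pose t i := a + i%:R * ((b - a) / n%:R).
have ts i : t i.+1 - t i = (b - a) / n%:R by rewrite /t -natr1; ring.
have h0 : 0 <= (b - a) / n%:R by rewrite divr_ge0 ?subr_ge0 // ltW.
have tn : t n = b by rewrite /t mulrC divfK ?gt_eqF // addrC subrK.
have t0 : t 0%N = a by rewrite /t mul0r addr0.
have : `|D b - D a| <= \sum_(0 <= i < n) (b - a) / n%:R * (f (t i.+1) - f (t i)).
  rewrite -tn -{1}t0 -(telescope_sumr (fun i => D (t i))) // tn.
  apply: le_trans (ler_norm_sum _ _ _) _; apply: ler_sum => i _.
  by rewrite -{1}(ts i); apply: DD; rewrite -subr_ge0 ts.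
rewrite -mulr_sumr (telescope_sumr (fun i => f (t i))) // tn t0.
rewrite mulrAC ler_pdivlMr // -/K => h; move: nK; rewrite mulrC.
by rewrite ltNge h.
Qed.

(** The function [G (x + 1) - G x - x] formally has derivative [f (x + 1) - f x - 1 = 0]. The
    subgradient inequalities at both ends bound its increments by [(b - a) * (f b - f a)], which
    makes it constant. *)
Lemma exists_convex_primitive f : {homo f : x y / x <= y} -> continuous f ->
  (forall x, f (x + 1) = f x + 1) -> exists G c, convex_primitive f G c.
Proof.
move=> fh fc f1; have [G sg] := exists_subgradient fh fc.
exists G, (G 1 - G 0); split => // x.
suff : G (0 + 1) - G 0 - 0 = G (x + 1) - G x - x by rewrite add0r; lra.
apply: (@sub_increment_cst (fun x => G (x + 1) - G x - x) f) => // a b ab.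
have := sg (a + 1) (b + 1); have := sg (b + 1) (a + 1).
have := sg a b; have := sg b a; rewrite !f1 ler_norml.
by have := fh _ _ ab; nra.
Qed.

End primitive.

Lemma period1_int {R : realType} (T : Type) (F : R -> T) :
  (forall x, F (x + 1) = F x) -> forall x (n : int), F (x + n%:~R) = F x.
Proof.
move=> F1.
have Fn x (n : nat) : F (x + n%:R) = F x.
  by elim: n => [|n IH]; rewrite ?addr0 // -natr1 addrA F1.
move=> x [n|n]; first exact: Fn.
by rewrite NegzE mulrNz -[in LHS](Fn _ n.+1) subrK.
Qed.

Lemma shift1_int {R : realType} (f : R -> R) :
  (forall x, f (x + 1) = f x + 1) ->
  forall x (n : int), f (x + n%:~R) = f x + n%:~R.
Proof.
move=> f1 x n; have := @period1_int R _ (fun t => f t - t) _ x n.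
move=> H; have : f (x + n%:~R) - (x + n%:~R) = f x - x.
  by apply: H => t; rewrite f1; ring.
by lra.
Qed.

Lemma int_near {R : realType} (t : R) : exists n : int, `|t + n%:~R| <= 1 / 2.
Proof.
exists (- Num.floor (t + 1 / 2)); have := floor_itv (t + 1 / 2).
by rewrite intrD intrN ler_norml; lra.
Qed.

(** * Polar coordinates with angles in turns *)

Section polar_coordinates.
Context {R : realType}.
Implicit Types (z w : R * R) (r x : R).

Lemma cmod_ge0 z : 0 <= cmod z.
Proof. exact: sqrtr_ge0. Qed.

Lemma cmod_sqr z : cmod z ^+ 2 = z.1 ^+ 2 + z.2 ^+ 2.
Proof. by rewrite sqr_sqrtr // addr_ge0 // sqr_ge0. Qed.

Lemma cmod_eq r z : 0 <= r -> z.1 ^+ 2 + z.2 ^+ 2 = r ^+ 2 -> cmod z = r.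
Proof. by move=> r0 e; rewrite /cmod e sqrtr_sqr ger0_norm. Qed.

Lemma ler_cmodD z w : cmod (z + w) <= cmod z + cmod w.
Proof.
rewrite -ler_sqr ?nnegrE ?addr_ge0 ?cmod_ge0 // sqrrD !cmod_sqr /=.
have h : z.1 * w.1 + z.2 * w.2 <= cmod z * cmod w.
  apply: le_trans (ler_norm _) _.
  rewrite -ler_sqr ?nnegrE ?mulr_ge0 ?cmod_ge0 // real_normK ?num_real //.
  (* By Lagrange's identity this square is the defect in the Cauchy-Schwarz inequality. *)
  rewrite exprMn !cmod_sqr; have := sqr_ge0 (z.1 * w.2 - z.2 * w.1).
  by move: z.1 z.2 w.1 w.2 => a b c d; lra.
by move: h; rewrite mulr2n; lra.
Qed.

Lemma cmodN z : cmod (- z) = cmod z.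
Proof. by rewrite /cmod /= !sqrrN. Qed.

Lemma cmodB z w : cmod (z - w) = cmod (w - z).
Proof. by rewrite -opprB cmodN. Qed.

Lemma ler_cmod_dist z w : `|cmod z - cmod w| <= cmod (z - w).
Proof.
have := ler_cmodD (z - w) w; have := ler_cmodD (w - z) z.
by rewrite !subrK (cmodB w) ler_norml; lra.
Qed.

Lemma norm_le_cmod z : `|z| <= cmod z.
Proof.
have := sqr_ge0 z.1; have := sqr_ge0 z.2 => h2 h1.
rewrite prod_normE ge_max -!(ler_sqr (_ : `|_| \in _) (_ : cmod z \in _))
  ?nnegrE ?cmod_ge0 //.
by rewrite !real_normK ?num_real // cmod_sqr; apply/andP; split; lra.
Qed.

Lemma cmod_le_norm z : cmod z <= 2 * `|z|.
Proof.
rewrite -ler_sqr ?nnegrE ?cmod_ge0 ?mulr_ge0 // cmod_sqr exprMn.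
have h1 : z.1 ^+ 2 <= `|z| ^+ 2.
  by rewrite -(real_normK (num_real z.1)) ler_sqr ?nnegrE // prod_normE le_max lexx.
have h2 : z.2 ^+ 2 <= `|z| ^+ 2.
  by rewrite -(real_normK (num_real z.2)) ler_sqr ?nnegrE // prod_normE le_max lexx orbT.
by have := sqr_ge0 `|z|; lra.
Qed.

(* The angle is measured in turns. *)
Definition polar r x : R * R := (r * cos (2 * pi * x), r * sin (2 * pi * x)).

Lemma cmod_polar r x : 0 <= r -> cmod (polar r x) = r.
Proof.
move=> r0; apply: cmod_eq => //=; rewrite !exprMn -mulrDr.
by rewrite sin2cos2 addrC subrK mulr1.
Qed.

Lemma polarD1 r x : polar r (x + 1) = polar r x.
Proof.
rewrite /polar (_ : 2 * pi * (x + 1) = 2 * pi * x + pi *+ 2); last first.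
  by rewrite -mulr_natr; ring.
by rewrite cosD2pi sinD2pi.
Qed.

Lemma polarDz r x (n : int) : polar r (x + n%:~R) = polar r x.
Proof. exact: (period1_int (polarD1 r)). Qed.

Lemma polar_exists z : exists x, z = polar (cmod z) x.
Proof.
case: (eqVneq (cmod z) 0) => [z0|z0].
  exists 0; have := cmod_sqr z; rewrite z0 expr0n /= => /esym/eqP.
  rewrite paddr_eq0 ?sqr_ge0 // !sqrf_eq0 /polar !mul0r => /andP[/eqP h1 /eqP h2].
  by case: z h1 h2 {z0} => a b /= -> ->.
have zp : 0 < cmod z by rewrite lt_def z0 cmod_ge0.
set r := cmod z in z0 zp *.
have e : (z.1 / r) ^+ 2 + (z.2 / r) ^+ 2 = 1.
  by rewrite !expr_div_n -mulrDl -cmod_sqr divff // expf_neq0.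
have b : -1 <= z.1 / r <= 1.
  by have := sqr_ge0 (z.2 / r); move: e; move: (z.1 / r) (z.2 / r) => a b; nra.
have pi0 := pi_gt0 R.
have s : sin (acos (z.1 / r)) = `|z.2 / r|.
  by rewrite sin_acos // -e addrC addKr sqrtr_sqr.
have zE (t : R) : cos (2 * pi * t) = z.1 / r -> sin (2 * pi * t) = z.2 / r ->
    z = polar r t.
  move=> h1 h2; rewrite /polar h1 h2 !(mulrC r) !divfK //.
  by case: (z).
have ee (t : R) : 2 * pi * (t / (2 * pi)) = t by field; lra.
case: (leP 0 (z.2 / r)) => z2.
  exists (acos (z.1 / r) / (2 * pi)); apply: zE; rewrite ee.
    by rewrite acosK // in_itv.
  by rewrite s ger0_norm.
exists (- acos (z.1 / r) / (2 * pi)); apply: zE; rewrite ee.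
  by rewrite cosN acosK // in_itv.
by rewrite sinN s ltr0_norm // opprK.
Qed.

Lemma polar_near z x0 : exists2 x, z = polar (cmod z) x & `|x - x0| <= 1 / 2.
Proof.
have [x e] := polar_exists z; have [n h] := int_near (x - x0).
by exists (x + n%:~R); rewrite ?polarDz // addrAC.
Qed.

(** The mean value theorem gives [sin (t / 2) >= t / 2 * cos (t / 2)]. Doubling the angle yields
    [sin t >= t * cos (t / 2) ^ 2], and this squared cosine is [(1 + cos t) / 2 >= 1 / 2]. *)
Lemma sin_lower t : 0 <= t -> t <= pi / 2 -> t / 2 <= sin t :> R.
Proof.
move=> t0 tpi; have pi0 := pi_gt0 R.
have u0 : 0 <= t / 2 by lra.
have h : t / 2 * cos (t / 2) <= sin (t / 2).
  have sd x : x \in `]0, t / 2[ -> is_derive x 1 sin (cos x).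
    by move=> _; exact: is_derive_sin.
  have sc : {within `[0, t / 2], continuous sin}.
    by apply: continuous_subspaceT => x; exact: continuous_sin.
  have [c] := MVT_segment u0 sd sc.
  rewrite in_itv /= sin0 !subr0 => /andP[c0 ct] ->; rewrite mulrC ler_wpM2r //.
  rewrite leNgt ltr_cos ?in_itv /=; try lra.
have c0 : 0 <= cos (t / 2) by apply: cos_ge0_pihalf; lra.
have ct : 0 <= cos t by apply: cos_ge0_pihalf; lra.
have tE : t = (t / 2) *+ 2 by rewrite -mulr_natr; field.
have := sin_mulr2n (t / 2); have := cos_mulr2n (t / 2); rewrite -tE.
rewrite [_ ^+ 2 *+ 2]mulr2n [_ * _ *+ 2]mulr2n.
move=> e1 ->; have cs := ler_wpM2r c0 h.
have c2 : 1 / 2 <= cos (t / 2) * cos (t / 2) by rewrite -expr2; lra.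
by have := ler_wpM2l t0 c2; lra.
Qed.

(** The chord has length [2 * sin (pi * d)] for [d] the difference of angles; half a turn keeps
    [pi * d] within the range of [sin_lower], and [pi >= 2]. *)
Lemma polar_chord x x0 : `|x - x0| <= 1 / 2 ->
  2 * `|x - x0| <= cmod (polar 1 x - polar 1 x0).
Proof.
have pi2 := pi_ge2 R; move=> h.
rewrite -ler_sqr ?nnegrE ?cmod_ge0 ?mulr_ge0 // cmod_sqr /= !mul1r.
set a := 2 * pi * x; set b := 2 * pi * x0.
have -> : (cos a - cos b) ^+ 2 + (sin a - sin b) ^+ 2 =
    4 * sin (pi * `|x - x0|) ^+ 2.
  have e : cos (a - b) = 1 - 2 * sin (pi * `|x - x0|) ^+ 2.
    have -> : cos (a - b) = cos ((pi * `|x - x0|) *+ 2).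
      rewrite -cos_norm /a /b -mulrBr normrM ger0_norm; last by lra.
      by congr (cos _); rewrite mulr2n; ring.
    by rewrite cos_mulr2n cos2sin2 -mulr_natr; ring.
  have := cosB a b; rewrite e; have := cos2sin2 a; have := cos2sin2 b.
  by move: (sin (pi * _)) (cos a) (cos b) (sin a) (sin b) => *; lra.
have : pi * `|x - x0| / 2 <= sin (pi * `|x - x0|).
  apply: sin_lower; first by rewrite mulr_ge0 //; lra.
  by have := ler_wpM2l (pi_ge0 R) h; lra.
have d0 := normr_ge0 (x - x0).
have := ler_wpM2r d0 pi2.
move: `|x - x0| d0 (sin _) => d d0 s dpi ds.
have : d ^+ 2 <= s ^+ 2 by rewrite ler_sqr ?nnegrE; lra.
by rewrite exprMn; lra.
Qed.

Lemma polar_inj x x' : polar 1 x = polar 1 x' -> exists n : int, x' = x + n%:~R.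
Proof.
move=> e; have [n h] := int_near (x - x'); exists n.
have h' : `|x + n%:~R - x'| <= 1 / 2 by rewrite addrAC.
have := polar_chord h'; rewrite polarDz e subrr.
rewrite (@cmod_eq 0) //= ?expr0n ?addr0 // pmulr_rle0 // normr_le0 subr_eq0.
by move=> /eqP.
Qed.

Lemma pi_lt4 : pi < 4 :> R.
Proof. by have := pihalf_lt2 R; lra. Qed.

Lemma derive_le1_lipschitz (g dg : R -> R) (a b : R) :
  (forall t : R, is_derive t (1 : R) g (dg t)) -> (forall t, `|dg t| <= 1) ->
  `|g a - g b| <= `|a - b|.
Proof.
move=> gd dg1; wlog ab : a b / b <= a.
  by move=> H; case: (leP b a) => [/H//|/ltW/H]; rewrite distrC (distrC a).
have gc : {within `[b, a], continuous g}.
  by apply: continuous_subspaceT => t; apply: differentiable_continuous;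
    apply/derivable1_diffP; have [] := gd t.
have [c _ ->] := MVT_segment ab (fun t _ => gd t) gc.
by rewrite normrM ler_piMl.
Qed.

(** The angular term carries only the radius [r'] of the base point, which later compensates for
    large changes of angle near the origin. The 8 bounds [2 * pi]. *)
Lemma polar_lipschitz r r' x x' :
  `|polar r x - polar r' x'| <= `|r - r'| + 8 * `|r'| * `|x - x'|.
Proof.
have H (g : R -> R) : (forall t, `|g t| <= 1) ->
    (forall a b, `|g a - g b| <= `|a - b|) ->
    `|r * g (2 * pi * x) - r' * g (2 * pi * x')| <= `|r - r'| + 8 * `|r'| * `|x - x'|.
  move=> g1 gl; rewrite (_ : _ - _ = (r - r') * g (2 * pi * x) +
    r' * (g (2 * pi * x) - g (2 * pi * x'))); last by ring.
  apply: le_trans (ler_normD _ _) _; rewrite !normrM; apply: lerD.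
    by rewrite ler_piMr.
  rewrite (_ : 8 * _ * _ = `|r'| * (8 * `|x - x'|)); last by ring.
  apply: ler_wpM2l => //.
  apply: le_trans (gl _ _) _; rewrite -mulrBr normrM ler_wpM2r //.
  by have := pi_lt4; have := pi_gt0 R => p0 p4; rewrite ger0_norm; lra.
rewrite prod_normE ge_max; apply/andP; split; apply: H.
- exact: cos_max.
- move=> a b; apply: (@derive_le1_lipschitz cos (fun t => - sin t)).
  by move=> t; rewrite normrN sin_max.
- exact: sin_max.
- by move=> a b; apply: (@derive_le1_lipschitz sin cos) => // t; exact: cos_max.
Qed.

End polar_coordinates.

(** * Monotone lifts of circle homeomorphisms *)

Section circle_lift.
Context {R : realType}.

(** A jump of a monotone function would leave a gap in its image. This yields continuity of the lift
    at the integers as well, where it is glued. *)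
Lemma homo_surj_continuous (g : R -> R) : {homo g : x y / x <= y} ->
  (forall v, exists x, g x = v) -> continuous g.
Proof.
move=> gh gs x; apply/cvgrPdist_lt => e e0.
have [x1 e1] := gs (g x - e / 2); have [x2 e2] := gs (g x + e / 2).
have x1x : x1 < x by rewrite ltNge; apply/negP => /gh; lra.
have xx2 : x < x2 by rewrite ltNge; apply/negP => /gh; lra.
have : \forall t \near x, t \in `]x1, x2[.
  by apply: near_in_itvoo; rewrite in_itv /= x1x.
apply: filterS => t; rewrite in_itv /= => /andP[/ltW/gh h1 /ltW/gh h2].
by rewrite ltr_norml; lra.
Qed.

Context {phi : R * R -> R * R}.
Hypothesis hphi : homeomorphism_on (@unit_circle R) (@unit_circle R) phi.

Lemma polar1_circle (x : R) : unit_circle (polar 1 x).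
Proof. by rewrite /unit_circle /= cmod_polar. Qed.

Lemma circle_polar1 z : @unit_circle R z -> exists x, z = polar 1 x.
Proof. by move=> e; have [x ->] := polar_exists z; exists x; rewrite e. Qed.

Lemma phi_polar_exists t : exists x, phi (polar 1 t) = polar 1 x.
Proof. by case: hphi => -[h _ _] _ _; apply/circle_polar1/h/polar1_circle. Qed.

Lemma phi_polar_inj t t' : phi (polar 1 t) = phi (polar 1 t') ->
  exists n : int, t' = t + n%:~R.
Proof.
case: hphi => -[_ h _] _ _ e; apply: polar_inj; apply: h e;
  by rewrite inE; exact: polar1_circle.
Qed.

Lemma phi_polar_continuous : continuous (phi \o polar 1).
Proof.
case: hphi => _ hc _ t; have /subspace_continuousP/(_ _ (polar1_circle t)) := hc.
apply: cvg_comp => P; rewrite /within /=.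
move=> /nbhs_ballP[e /= e0 eP]; apply/nbhs_ballP; exists (e / 8) => /=.
  by rewrite divr_gt0.
move=> u /= tu; apply: eP; last exact: polar1_circle.
rewrite -ball_normE /= in tu *; apply: le_lt_trans (polar_lipschitz _ _ _ _) _.
by rewrite subrr normr0 normr1 add0r mulr1 mulrC -ltr_pdivlMr.
Qed.

(* [be] is the lift on [0, 1); s = -1 when phi reverses the orientation. *)
Lemma lift_of_fractional_part (s th : R) (be : R -> R) : (s = 1 \/ s = -1) ->
  be 0 = 0 -> (forall t, 0 <= t < 1 -> 0 <= be t < 1) ->
  (forall t u, 0 < t -> t <= u -> u < 1 -> be t <= be u) ->
  (forall t, 0 <= t < 1 -> phi (polar 1 t) = polar 1 (s * (th + be t))) ->
  exists f : R -> R, [/\ {homo f : x y / x <= y}, continuous f,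
    forall x, f (x + 1) = f x + 1 &
    forall x, phi (polar 1 x) = polar 1 (s * f x)].
Proof.
move=> s1 be0 beb beh ph.
pose fr x : R := x - (Num.floor x)%:~R.
have frb x : 0 <= fr x < 1 by have := floor_itv x; rewrite intrD /fr; lra.
pose g x := th + (Num.floor x)%:~R + be (fr x).
have gh : {homo g : x y / x <= y}.
  move=> x y xy; rewrite /g.
  have := le_floor xy; rewrite le_eqVlt => /predU1P[e|].
    rewrite e lerD2l; have := frb x; have := frb y.
    have : fr x <= fr y by rewrite /fr e; lra.
    case: (ltgtP (fr x) 0) => [||->]; [by lra| |].
      by move=> h1 h2 /andP[_ h3] _; exact: beh.
    by rewrite be0 => _ /beb/andP[].
  rewrite -lezD1 -(ler_int R) intrD => h.
  by have := beb _ (frb x); have := beb _ (frb y); lra.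
have g1 x : g (x + 1) = g x + 1.
  have e : Num.floor (x + 1) = Num.floor x + 1.
    by rewrite floorDrz ?floor1 ?int_num1.
  rewrite /g /fr e intrD (_ : x + 1 - _ = x - (Num.floor x)%:~R); last by ring.
  by ring.
have gphi x : phi (polar 1 x) = polar 1 (s * g x).
  rewrite -[x](subrK (Num.floor x)%:~R) polarDz subrK -/(fr x) ph //.
  case: s1 => ->; rewrite /g.
    by rewrite -(polarDz _ _ (Num.floor x)); congr (polar 1 _); ring.
  rewrite -(polarDz _ _ (- Num.floor x)) intrN.
  by congr (polar 1 _); ring.
exists g; split => //; apply: homo_surj_continuous => // v.
case: hphi => -[_ _ hs] _ _.
have [w /circle_polar1[x ->]] := hs _ (polar1_circle (s * v)).
rewrite gphi => /polar_inj[n e].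
have gz := shift1_int g1.
case: s1 e => -> e; [exists (x + n%:~R)|exists (x + (- n)%:~R)]; rewrite gz ?intrN; lra.
Qed.

(** Measured from [th], the angle [al] of the image stays in []0, 1[] on the open unit interval.
    There it is continuous and injective, hence strictly monotone; the decreasing case is reduced to
    an increasing function by reflection. *)
Lemma circle_lift : exists (s : R) (f : R -> R), [/\ s = 1 \/ s = -1,
    {homo f : x y / x <= y}, continuous f,
    forall x, f (x + 1) = f x + 1 &
    forall x, phi (polar 1 x) = polar 1 (s * f x)].
Proof.
have [th phi0] := phi_polar_exists 0.
have int01 (x y : R) (n : int) : 0 <= x < 1 -> 0 <= y < 1 -> y = x + n%:~R -> x = y.
  move=> hx hy e.
  have : -1 < n%:~R :> R by lra.
  have : n%:~R < 1 :> R by lra.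
  rewrite (_ : 1 = 1%:~R) // -mulrNz !ltr_int => n1 n2.
  have n0 : n = 0 by lia.
  by rewrite e n0 addr0.
have ex t : exists a : R, 0 <= a < 1 /\ phi (polar 1 t) = polar 1 (th + a).
  have [x ->] := phi_polar_exists t.
  exists (x - th + (- Num.floor (x - th))%:~R); split.
    by rewrite intrN; have := floor_itv (x - th); rewrite intrD; lra.
  by rewrite addrA polarDz addrC subrK.
have [al /all_and2[alb alE]] := choice ex.
have uniq_al t (a : R) : 0 <= a < 1 -> phi (polar 1 t) = polar 1 (th + a) -> al t = a.
  move=> a01; rewrite alE => /polar_inj[n e]; apply: (@int01 _ _ n) => //; lra.
have al0 : al 0 = 0 by apply: uniq_al; rewrite ?addr0 // lexx ltr01.
have alp t : 0 < t < 1 -> 0 < al t < 1.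
  move=> t01; have /andP[] := alb t; rewrite le_eqVlt => /predU1P[a0|->//] _.
  have : phi (polar 1 0) = phi (polar 1 t) by rewrite phi0 alE -a0 addr0.
  by move=> /phi_polar_inj[n /(int01 _ _)]; lra.
have al_inj : {in `]0, 1[ &, injective al}.
  move=> t u; rewrite !in_itv /= => t01 u01 e.
  have : phi (polar 1 t) = phi (polar 1 u) by rewrite !alE e.
  by move=> /phi_polar_inj[n]; apply: int01; lra.
have al_cont : {within `]0, 1[, continuous al}.
  apply: continuous_in_subspaceT => t; rewrite inE /= in_itv /= => t01.
  have a01 := alp t t01; apply/cvgrPdist_lt => e e0.
  (* The last two terms keep a nearby angle inside [[0, 1)], so that it must be the value of
     [al]. *)
  pose d := Num.min e (Num.min (al t) (1 - al t)).
  have d0 : 0 < d by rewrite !lt_min e0; lra.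
  have /cvgrPdist_lt/(_ _ d0) := @phi_polar_continuous t.
  apply: filterS => u /=; rewrite !lt_min => /and3P[].
  have [x ux xt] := polar_near (phi (polar 1 u)) (th + al t).
  have cu : cmod (phi (polar 1 u)) = 1.
    by case: hphi => -[h _ _] _ _; exact: (h _ (polar1_circle u)).
  rewrite cu in ux; rewrite [in `|_ - _|]alE ux.
  have := polar_chord xt; rewrite cmodB.
  have := cmod_le_norm (polar 1 (th + al t) - polar 1 x).
  move: `|polar _ _ - _| => D h1 h2 h3 h4 h5.
  have xb : `|x - (th + al t)| <= D by lra.
  have axu : al u = x - th.
    apply: uniq_al; last by rewrite ux addrC subrK.
    by move: xb; rewrite ler_norml; lra.
  rewrite axu distrC; apply: le_lt_trans h3; rewrite (le_trans _ xb) //.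
  by rewrite ler_norml -ler_norml opprD addrA.
case: (itv_continuous_inj_mono al_cont al_inj) => al_mono.
  have alh t u : 0 < t -> t <= u -> u < 1 -> al t <= al u.
    rewrite le_eqVlt => t0 /predU1P[->//|tu] u1; apply/ltW/al_mono => //;
      by rewrite in_itv /=; apply/andP; split; lra.
  have phE t : 0 <= t < 1 -> phi (polar 1 t) = polar 1 (1 * (th + al t)).
    by rewrite mul1r alE.
  have [f [? ? ? ?]] :=
    lift_of_fractional_part (or_introl erefl) al0 (fun t _ => alb t) alh phE.
  by exists 1, f; split => //; left.
(* At 0 the formula [1 - al t] would give 1, which lies outside [[0, 1)]. *)
pose be t := if t == 0 then 0 else 1 - al t.
have beb t : 0 <= t < 1 -> 0 <= be t < 1.
  move=> t01; rewrite /be; case: eqP => [_|/eqP t0]; first by rewrite lexx ltr01.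
  have /alp : 0 < t < 1 by move: t01; rewrite le_eqVlt eq_sym (negPf t0).
  by lra.
have beh t u : 0 < t -> t <= u -> u < 1 -> be t <= be u.
  rewrite le_eqVlt => t0 /predU1P[->//|tu] u1.
  have u0 := lt_trans t0 tu; rewrite /be !gt_eqF // lerD2l lerN2.
  by apply/ltW/al_mono => //; rewrite in_itv /=; apply/andP; split; lra.
have be0 : be 0 = 0 by rewrite /be eqxx.
have phE t : 0 <= t < 1 -> phi (polar 1 t) = polar 1 (-1 * (- th + be t)).
  move=> _; rewrite /be; case: eqP => [->|_].
    by rewrite phi0; congr (polar 1 _); ring.
  rewrite alE -[RHS]polarD1; congr (polar 1 _); ring.
have [f [? ? ? ?]] := lift_of_fractional_part (or_intror erefl) be0 beb beh phE.
by exists (-1), f; split => //; right.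
Qed.
End circle_lift.

(* At y = 0 both edges are the boundary function f.  The terms [y / 4] make the
   monotonicity in y strict and let the image reach the origin at y = 2. *)
Definition top_edge {R : realType} (f G : R -> R) (c x y : R) : R :=
  if y <= 0 then f x else upper G c x y + y / 4.

Definition bottom_edge {R : realType} (f G : R -> R) (c x y : R) : R :=
  if y <= 0 then f x else lower G c x y - y / 4.

(** * Monotonicity and regularity of the two edges *)

Section edges.
Context {R : realType} {f G : R -> R} {c : R}.
Hypothesis cpG : convex_primitive f G c.
Hypothesis f_cont : continuous f.

Local Notation top := (top_edge f G c).
Local Notation bot := (bottom_edge f G c).

Lemma top_edge_gt0 (x y : R) : 0 < y -> top x y = upper G c x y + y / 4.
Proof. by rewrite /top_edge ltNge => /negPf ->. Qed.

Lemma bottom_edge_gt0 (x y : R) : 0 < y -> bot x y = lower G c x y - y / 4.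
Proof. by rewrite /bottom_edge ltNge => /negPf ->. Qed.

Lemma top_edgeD1 (y x : R) : top (x + 1) y = top x y + 1.
Proof.
rewrite /top_edge; case: ifPn => [_|]; first exact: cp_fD1 cpG _.
by rewrite -ltNge => y0; rewrite (upperD1 cpG) //; ring.
Qed.

Lemma bottom_edgeD1 (y x : R) : bot (x + 1) y = bot x y + 1.
Proof.
rewrite /bottom_edge; case: ifPn => [_|]; first exact: cp_fD1 cpG _.
by rewrite -ltNge => y0; rewrite (lowerD1 cpG) //; ring.
Qed.

Lemma top_edge_lt_x (x x' y : R) : 0 < y -> x < x' -> top x y < top x' y.
Proof. by move=> y0 xx'; rewrite !top_edge_gt0 // ltrD2r (upper_lt_x cpG). Qed.

Lemma bottom_edge_lt_x (x x' y : R) : 0 < y -> x < x' -> bot x y < bot x' y.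
Proof. by move=> y0 xx'; rewrite !bottom_edge_gt0 // ltrD2r (lower_lt_x cpG). Qed.

Lemma top_edge_lt_y (x y y' : R) : 0 < y -> y < y' -> top x y < top x y'.
Proof.
move=> y0 yy'; have y'0 := lt_trans y0 yy'; rewrite !top_edge_gt0 //.
by have := upper_homo_y cpG x y0 (ltW yy'); lra.
Qed.

Lemma bottom_edge_gt_y (x y y' : R) : 0 < y -> y < y' -> bot x y' < bot x y.
Proof.
move=> y0 yy'; have y'0 := lt_trans y0 yy'; rewrite !bottom_edge_gt0 //.
by have := lower_nhomo_y cpG x y0 (ltW yy'); lra.
Qed.

(** If [x < x'], then [y <= y'] makes the top edge strictly smaller at the first point, while
    [y > y'] makes the bottom edge strictly smaller there. *)
Lemma edges_inj (x y x' y' : R) : 0 < y -> 0 < y' ->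
  top x y = top x' y' -> bot x y = bot x' y' -> x = x' /\ y = y'.
Proof.
move=> y0 y'0; wlog xx' : x y x' y' y0 y'0 / x <= x'.
  move=> H e1 e2; case: (leP x x') => [h|/ltW h]; first exact: H.
  by have [-> ->] := H _ _ _ _ y'0 y0 h (esym e1) (esym e2).
move: xx'; rewrite le_eqVlt => /predU1P[<-|xx'] e1 e2.
  split=> //; case: (ltgtP y y') => // yy'.
    by have := top_edge_lt_y x y0 yy'; rewrite e1 ltxx.
  by have := top_edge_lt_y x y'0 yy'; rewrite e1 ltxx.
exfalso; case: (leP y y') => [|y'y].
  rewrite le_eqVlt => /predU1P[e|/(top_edge_lt_y x y0)].
    by have := top_edge_lt_x y0 xx'; rewrite e1 e ltxx.
  by have := top_edge_lt_x y'0 xx'; rewrite -e1; lra.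
have := bottom_edge_gt_y x y'0 y'y; have := bottom_edge_lt_x y'0 xx'; lra.
Qed.

Lemma edges_gap_ge (x y : R) : 0 <= y -> y / 2 <= top x y - bot x y.
Proof.
rewrite le_eqVlt => /predU1P[<-|y0].
  by rewrite /top_edge /bottom_edge lexx; lra.
rewrite top_edge_gt0 // bottom_edge_gt0 //.
by have := width_ge0 cpG x y0; rewrite /width; lra.
Qed.

Lemma edges_gap0 (x : R) : top x 0 - bot x 0 = 0.
Proof. by rewrite /top_edge /bottom_edge lexx subrr. Qed.

Lemma top_edge_ge1 (x y : R) : 1 <= y -> top x y = x + c + y / 4.
Proof. by move=> y1; rewrite top_edge_gt0 ?(upper_ge1 cpG) //; lra. Qed.

Lemma bottom_edge_ge1 (x y : R) : 1 <= y -> bot x y = x + c - 1 - y / 4.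
Proof. by move=> y1; rewrite bottom_edge_gt0 ?(lower_ge1 cpG) //; lra. Qed.

Lemma edges_gap_lt2 (x y : R) : 0 <= y -> y < 2 -> top x y - bot x y < 2.
Proof.
rewrite le_eqVlt => /predU1P[<- _|y0 y2]; first by rewrite edges_gap0.
have := top_edge_lt_y x y0 y2; have := bottom_edge_gt_y x y0 y2.
by rewrite (@top_edge_ge1 x 2) ?(@bottom_edge_ge1 x 2); lra.
Qed.

Lemma edges_near_boundary (x0 e : R) : 0 < e ->
  exists2 d, 0 < d & forall x y, `|x - x0| < d -> 0 <= y -> y < d ->
    `|top x y - f x0| < e /\ `|bot x y - f x0| < e.
Proof.
move=> e0; have e4 : 0 < e / 4 by lra.
have /cvgrPdist_lt/(_ _ e4)/nbhs_ballP[n /= n0 fn] := @f_cont x0.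
pose t := Num.min (n / 2) 1.
have t0 : 0 < t by rewrite lt_min; lra.
have [tn t1] : t <= n / 2 /\ t <= 1 by rewrite /t !ge_min !lexx orbT.
have [m me] : exists m, (1 / 4) ^+ m < e / 4.
  exists (Num.truncn (4 / e)).+1; rewrite expr_div_n expr1n.
  rewrite ltr_pdivrMr ?exprn_gt0 // -ltr_pdivrMl // mulr1 invf_div.
  apply: lt_le_trans (truncnS_gt _) _.
  by rewrite -natrX ler_nat ltnW // ltn_expl.
(* The first bound keeps [x - t], [x] and [x + t] within [n] of [x0], the second makes [y / 4]
   small, and the third puts [m] scales below [t]. *)
pose d := Num.min (n / 2) (Num.min e (t / 2 ^+ m)).
have d0 : 0 < d.
  by rewrite !lt_min e0 (divr_gt0 t0 (exprn_gt0 _ _)) // divr_gt0.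
exists d => // x y; rewrite !lt_min => /and3P[xn _ _] y0 /and3P[_ ye yt].
have fb p : `|p - x0| < n -> `|f p - f x0| < e / 4.
  by move=> pn; rewrite distrC; apply: fn; rewrite -ball_normE /= distrC.
have xb := xn; rewrite ltr_norml in xb.
have fx : `|f x - f x0| < e / 4 by apply: fb; lra.
have fxp : `|f (x + t) - f x0| < e / 4 by apply: fb; rewrite ltr_norml; lra.
have fxm : `|f (x - t) - f x0| < e / 4 by apply: fb; rewrite ltr_norml; lra.
move: fx fxp fxm; rewrite !ltr_norml.
move: y0; rewrite le_eqVlt => /predU1P[<-|y0].
  by rewrite /top_edge /bottom_edge lexx => *; split; lra.
have my : 2 ^+ m * y <= t.
  by rewrite ltr_pdivlMr ?exprn_gt0 // in yt; rewrite mulrC ltW.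
have := upper_near_boundary cpG x y0 t1 my.
have := lower_near_boundary cpG x y0 t1 my.
have := upper_bounds cpG x y0; have := lower_bounds cpG x y0.
rewrite top_edge_gt0 // bottom_edge_gt0 //.
move: ((1 / 4) ^+ m) me => q qe *; split; lra.
Qed.

(** For [y0 <= 2] one has [min y0 1 >= y0 / 2], which doubles the constant 32. The variation of
    [y / 4] is absorbed by the part [y0 / 2] of the gap between the edges. *)
Lemma edges_lipschitz (x0 y0 x y : R) : 0 < y0 -> y0 <= 2 ->
  `|x - x0| <= y0 / 4 -> `|y - y0| <= y0 / 4 ->
  `|top x y - top x0 y0| <=
    65 * ((top x0 y0 - bot x0 y0) / y0) * (`|x - x0| + `|y - y0|) /\
  `|bot x y - bot x0 y0| <=
    65 * ((top x0 y0 - bot x0 y0) / y0) * (`|x - x0| + `|y - y0|).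
Proof.
move=> y00 y02 hx hy.
have yp : 0 < y by move: hy; rewrite ler_norml; lra.
have mp := min1_gt0 y00.
have my : (Num.min y0 1)^-1 <= 2 / y0.
  by rewrite ler_pdivlMr // mulrC ler_pdivrMr // minEle; case: ifP => ?; lra.
have yi : 0 < y0^-1 by rewrite invr_gt0.
have w0 := width_ge0 cpG x0 y00.
have gapE : top x0 y0 - bot x0 y0 = width G c x0 y0 + y0 / 2.
  by rewrite top_edge_gt0 // bottom_edge_gt0 // /width; lra.
set D := `|x - x0| + `|y - y0|.
have D0 : 0 <= D by rewrite addr_ge0.
have dE : `|x - x0| / Num.min y0 1 + `|y - y0| / y0 <= 2 * (D / y0).
  rewrite (_ : 2 * _ = `|x - x0| * (2 / y0) + 2 * (`|y - y0| / y0)); last first.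
    by rewrite /D; ring.
  apply: lerD; first by rewrite ler_wpM2l.
  have : 0 <= `|y - y0| / y0 by rewrite divr_ge0 // ltW.
  lra.
have key : 32 * width G c x0 y0 *
    (`|x - x0| / Num.min y0 1 + `|y - y0| / y0) + `|y - y0| / 4 <=
    65 * ((top x0 y0 - bot x0 y0) / y0) * D.
  apply: (@le_trans _ _ (32 * width G c x0 y0 * (2 * (D / y0)) + D / 4)).
    apply: lerD; first by apply: ler_wpM2l => //; rewrite mulr_ge0.
    by rewrite ler_pM2r // /D lerDr.
  rewrite gapE (_ : 65 * _ * D =
    65 * width G c x0 y0 * (D / y0) + 65 / 2 * D); last first.
    by field; lra.
  have : 0 <= width G c x0 y0 * (D / y0) by rewrite mulr_ge0 // divr_ge0 // ltW.
  by lra.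
have yy : `|y / 4 - y0 / 4| = `|y - y0| / 4.
  by rewrite -mulrBl normrM (@ger0_norm _ 4^-1).
split; apply: le_trans key.
  rewrite !top_edge_gt0 // (_ : _ - _ = (upper G c x y - upper G c x0 y0) +
    (y / 4 - y0 / 4)); last by ring.
  apply: le_trans (ler_normD _ _) _; rewrite yy lerD2r.
  exact: (upper_lipschitz cpG y00 hx hy).
rewrite !bottom_edge_gt0 // (_ : _ - _ = (lower G c x y - lower G c x0 y0) -
  (y / 4 - y0 / 4)); last by ring.
apply: le_trans (ler_normB _ _) _; rewrite yy lerD2r.
exact: (lower_lipschitz cpG y00 hx hy).
Qed.

End edges.

(** * Surjectivity of the pair of edges *)

Section edges_surj.
Context {R : realType} {f G : R -> R} {c : R}.
Hypothesis cpG : convex_primitive f G c.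
Hypothesis f_cont : continuous f.

Local Notation top := (top_edge f G c).
Local Notation bot := (bottom_edge f G c).

Lemma shift1_cont_surj (g : R -> R) : (forall x, g (x + 1) = g x + 1) ->
  continuous g -> forall a, exists x, g x = a.
Proof.
move=> g1 gc a; pose n := Num.floor (a - g 0).
have /andP[n1 n2] := floor_itv (a - g 0).
have gn (m : int) : g m%:~R = g 0 + m%:~R by rewrite -(shift1_int g1) add0r.
have n01 : n%:~R <= (n + 1)%:~R :> R by rewrite ler_int lerDl.
have gc' : {within `[n%:~R, (n + 1)%:~R], continuous g} by exact: continuous_subspaceT.
have [|x _ <-] := @IVT _ g _ _ a n01 gc'; last by exists x.
rewrite !gn ge_min le_max; rewrite -/n in n1 n2.
by apply/andP; split; apply/orP; [left|right]; lra.
Qed.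

Lemma edges_locally_lipschitz (x0 y0 : R) : 0 < y0 -> y0 <= 2 ->
  exists2 K, 0 < K & forall x y, `|x - x0| <= y0 / 4 -> `|y - y0| <= y0 / 4 ->
    `|top x y - top x0 y0| <= K * (`|x - x0| + `|y - y0|) /\
    `|bot x y - bot x0 y0| <= K * (`|x - x0| + `|y - y0|).
Proof.
move=> y00 y02; exists (65 * ((top x0 y0 - bot x0 y0) / y0)).
  have := edges_gap_ge cpG x0 (ltW y00).
  by move=> h; rewrite mulr_gt0 // divr_gt0 //; lra.
by move=> x y; exact: (edges_lipschitz cpG).
Qed.

Lemma edges_continuous (x0 y0 e : R) : 0 < y0 -> y0 <= 2 -> 0 < e ->
  exists2 d, 0 < d & forall x y, `|x - x0| < d -> `|y - y0| < d ->
    `|top x y - top x0 y0| < e /\ `|bot x y - bot x0 y0| < e.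
Proof.
move=> y00 y02 e0; have [K K0 H] := edges_locally_lipschitz x0 y00 y02.
exists (Num.min (y0 / 4) (e / (2 * K))).
  by rewrite lt_min !divr_gt0 // mulr_gt0.
move=> x y; rewrite !lt_min => /andP[xy xe] /andP[yy ye].
have [h1 h2] := H x y (ltW xy) (ltW yy).
suff : K * (`|x - x0| + `|y - y0|) < e.
  by move=> h; split; apply: le_lt_trans h.
rewrite -ltr_pdivlMl // mulrC (_ : e / K = e / (2 * K) + e / (2 * K)); last first.
  by field; lra.
exact: ltrD.
Qed.

(** Strict monotonicity puts the top edge at [X y0 - e] and [X y0 + e] on opposite sides of [a].
    This persists for nearby heights and traps [X y] between the two points. *)
Lemma top_edge_level (a : R) : exists X : R -> R,
  (forall y, 0 < y <= 2 -> top (X y) y = a) /\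
  (forall y, 0 < y < 2 -> {for y, continuous X}).
Proof.
have top_cont y : 0 < y -> y <= 2 -> continuous (fun x => top x y).
  move=> y0 y2 x0; apply/cvgrPdist_lt => e e0.
  have [d d0 H] := edges_continuous x0 y0 y2 e0.
  apply/nbhs_ballP; exists d => // x xd.
  have {}xd : `|x - x0| < d by rewrite distrC; exact: xd.
  by rewrite distrC; apply: (H x y _ _).1 => //; rewrite subrr normr0.
have ex (y : R) : exists x, 0 < y <= 2 -> top x y = a.
  case: (boolP (0 < y <= 2)) => [/andP[y0 y2]|]; last by exists 0.
  have [x] := shift1_cont_surj (fun x => top_edgeD1 cpG y x) (top_cont y y0 y2) a.
  by exists x.
have [X XE] := choice ex; exists X; split => // y0 /andP[y00 y02].
have topX : top (X y0) y0 = a by apply: XE; lra.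
apply/cvgrPdist_lt => e e0.
have tl : top (X y0 - e) y0 < a by rewrite -topX (top_edge_lt_x cpG) //; lra.
have tr : a < top (X y0 + e) y0 by rewrite -topX (top_edge_lt_x cpG) //; lra.
have y02' := ltW y02.
have tl0 : 0 < a - top (X y0 - e) y0 by rewrite subr_gt0.
have tr0 : 0 < top (X y0 + e) y0 - a by rewrite subr_gt0.
have [d1 d10 H1] := edges_continuous (X y0 - e) y00 y02' tl0.
have [d2 d20 H2] := edges_continuous (X y0 + e) y00 y02' tr0.
pose d := Num.min (Num.min d1 d2) (Num.min y0 (2 - y0)).
have d0 : 0 < d by rewrite !lt_min d10 d20 y00 subr_gt0.
apply/nbhs_ballP; exists d => // y yd.
have {yd} : `|y - y0| < d by rewrite distrC; exact: yd.
rewrite !lt_min => /andP[/andP[yd1 yd2] /andP[yy yy2]].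
have y0' : 0 < y by move: yy; rewrite ltr_norml; lra.
have y2 : y <= 2 by move: yy2; rewrite ltr_norml; lra.
have topy : top (X y) y = a by apply: XE; rewrite y0' y2.
have [] := H1 (X y0 - e) y _ yd1; rewrite ?subrr ?normr0 // ltr_norml => l1 _.
have [] := H2 (X y0 + e) y _ yd2; rewrite ?subrr ?normr0 // ltr_norml => l2 _.
have mono u w : top u y < top w y -> u < w.
  rewrite !ltNge; apply: contra; rewrite le_eqVlt => /predU1P[->//|h].
  by rewrite ltW // (top_edge_lt_x cpG).
have : X y0 - e < X y by apply: mono; rewrite topy; lra.
have : X y < X y0 + e by apply: mono; rewrite topy; lra.
by rewrite ltr_norml; lra.
Qed.

Lemma edges_surj (a b : R) : b < a -> a <= b + 2 ->
  exists x y, [/\ 0 < y, y <= 2, top x y = a & bot x y = b].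
Proof.
move=> ba ab2; case: (leP b (a - 3 / 2)) => bh.
  (* For [y >= 1] the gap is [1 + y / 2], so gaps of at least [3 / 2] are solved explicitly. Smaller
     gaps follow from the intermediate value theorem for the bottom edge along the curve where the
     top edge is [a]. *)
  exists (a - c - (a - b - 1) / 2), (2 * (a - b - 1)).
  by rewrite (top_edge_ge1 cpG) ?(bottom_edge_ge1 cpG); first split; lra.
have [X [topX X_cont]] := top_edge_level a.
have [xm fxm] := shift1_cont_surj (cp_fD1 cpG) f_cont ((a + b) / 2).
have ab0 : 0 < (a - b) / 4 by lra.
have [d d0 H] := edges_near_boundary cpG f_cont xm ab0.
pose y1 := Num.min (d / 2) 1.
have y10 : 0 < y1 by rewrite lt_min divr_gt0 ?ltr01.
have [y1d y11] : y1 <= d / 2 /\ y1 <= 1 by rewrite /y1 !ge_min !lexx orbT.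
have [] := H xm y1; rewrite ?subrr ?normr0 //; try lra.
rewrite fxm !ltr_norml => ht hb.
have topX1 : top (X y1) y1 = a by apply: topX; lra.
(* At [(xm, y1)] both edges lie within [(a - b) / 4] of the midpoint of [b] and [a], so the level
   curve of the top edge passes to the right of [xm]. There the bottom edge is still above [b]. *)
have X1 : xm < X y1.
  rewrite ltNge; apply/negP; rewrite le_eqVlt => /predU1P[e|/(top_edge_lt_x cpG y10)].
    by move: topX1; rewrite e; lra.
  by rewrite topX1; lra.
have b1 : b <= bot (X y1) y1.
  by have := bottom_edge_lt_x cpG y10 X1; lra.
have topX2 : top (X 1) 1 = a by apply: topX; lra.
have b2 : bot (X 1) 1 <= b.
  by move: topX2; rewrite (top_edge_ge1 cpG) ?(bottom_edge_ge1 cpG); lra.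
have botX_cont : {within `[y1, 1], continuous (fun y => bot (X y) y)}.
  apply: continuous_in_subspaceT => y0; rewrite inE /= in_itv /= => /andP[y10' y01].
  have [y00 y02] : 0 < y0 /\ y0 < 2 by lra.
  have /X_cont Xc : 0 < y0 < 2 by rewrite y00.
  apply/cvgrPdist_lt => e e0.
  have [d' d'0 H'] := edges_continuous (X y0) y00 (ltW y02) e0.
  have : \forall y \near y0, `|X y0 - X y| < d' by have /cvgrPdist_lt := Xc; exact.
  apply: filterS2 (nbhsx_ballx y0 d' d'0) => y yd Xd.
  rewrite distrC; apply: (H' _ _ _ _).2; rewrite distrC //; exact: yd.
have [|y] := IVT y11 botX_cont (_ : _ <= b <= _).
  by rewrite ge_min b2 orbT le_max b1.
rewrite in_itv /= => /andP[yy1 y1'] by_; exists (X y), y; split; try lra.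
  by apply: topX; lra.
Qed.
End edges_surj.

(** * The extension to the disk and its Lipschitz estimate *)

Definition depth {R : realType} (f G : R -> R) (c x y : R) : R :=
  (top_edge f G c x y - bottom_edge f G c x y) / 2.

Definition twist {R : realType} (f G : R -> R) (c x y : R) : R :=
  (top_edge f G c x y + bottom_edge f G c x y) / 2.

Lemma ler_half_combination {R : realType} (a b a' b' q : R) :
  `|a - a'| <= q -> `|b - b'| <= q ->
  `|(a - b) / 2 - (a' - b') / 2| <= q /\ `|(a + b) / 2 - (a' + b') / 2| <= q.
Proof. by rewrite !ler_norml => *; split; lra. Qed.

Section disk_extension.
Context {R : realType} {f G : R -> R} {c s : R}.
Hypothesis cpG : convex_primitive f G c.
Hypothesis s1 : s = 1 \/ s = -1.

Local Notation top := (top_edge f G c).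
Local Notation bot := (bottom_edge f G c).

(* At z = 0 the depth is 1, hence the arbitrary choice of an angle is harmless. *)
Definition disk_ext (z : R * R) : R * R :=
  let x := projT1 (cid (polar_exists z)) in
  let y := 2 * (1 - cmod z) in
  polar (1 - depth f G c x y) (s * twist f G c x y).

Local Notation v := (depth f G c).
Local Notation u := (twist f G c).

Lemma polar_sign_shift (r t : R) (n : int) : polar r (s * (t + n%:~R)) = polar r (s * t).
Proof.
case: s1 => ->; first by rewrite !mul1r polarDz.
by rewrite !mulN1r opprD -intrN polarDz.
Qed.

Lemma polar_sign_inj (t t' : R) : polar 1 (s * t) = polar 1 (s * t') ->
  exists n : int, t' = t + n%:~R.
Proof.
move=> /polar_inj[n]; case: s1 => -> e; [exists n|exists (- n)]; rewrite ?intrN; lra.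
Qed.

(** For positive [r] two angles of a point differ by an integer, which leaves the depth unchanged
    and shifts the twist by that integer. For [r = 0] both sides are the origin. *)
Lemma disk_extE (r x : R) : 0 <= r ->
  disk_ext (polar r x) =
  polar (1 - v x (2 * (1 - r))) (s * u x (2 * (1 - r))).
Proof.
move=> r0; rewrite /disk_ext; case: cid => x' /=; rewrite cmod_polar //.
move: r0; rewrite le_eqVlt => /predU1P[<- _|r0 e].
  have h12 : 1 <= 2 :> R by lra.
  rewrite subr0 mulr1 /depth !(top_edge_ge1 cpG) ?(bottom_edge_ge1 cpG) //.
  rewrite (_ : 1 - _ / 2 = 0); last by field.
  by rewrite (_ : 1 - _ / 2 = 0) ?/polar ?mul0r //; field.
have [n ->] : exists n : int, x' = x + n%:~R.
  have rn := lt0r_neq0 r0; case: e => /(mulfI rn) ce /(mulfI rn) se.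
  by apply: polar_inj; rewrite /polar ce se.
have topz y := shift1_int (fun t => top_edgeD1 cpG y t).
have botz y := shift1_int (fun t => bottom_edgeD1 cpG y t).
rewrite -[RHS](polar_sign_shift _ _ n) /depth /twist topz botz.
by congr (polar (1 - _ / 2) (s * _)); field.
Qed.

Lemma disk_depth (x y : R) : 0 <= y -> y <= 2 -> y / 4 <= v x y <= 1.
Proof.
move=> y0 y2; have := edges_gap_ge cpG x y0.
move: y2; rewrite le_eqVlt => /predU1P[->|y2].
  by rewrite /depth (top_edge_ge1 cpG) ?(bottom_edge_ge1 cpG); lra.
by have := edges_gap_lt2 cpG x y0 y2; rewrite /depth; lra.
Qed.

Lemma cmod_disk_ext (r x : R) : 0 <= r -> r <= 1 ->
  cmod (disk_ext (polar r x)) = 1 - v x (2 * (1 - r)).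
Proof.
move=> r0 r1; rewrite disk_extE // cmod_polar //.
by have := @disk_depth x (2 * (1 - r)); lra.
Qed.

Lemma disk_ext_circle (x : R) : disk_ext (polar 1 x) = polar 1 (s * f x).
Proof.
rewrite disk_extE // subrr mulr0 /depth /twist edges_gap0 mul0r subr0.
by rewrite /top_edge /bottom_edge lexx; congr (polar 1 (s * _)); lra.
Qed.

Lemma depth_twist_lipschitz (x0 y0 x y D : R) : 0 < y0 -> y0 <= 2 ->
  D <= y0 / 16 -> (1 - y0 / 2) * `|x - x0| <= D -> `|y - y0| <= 2 * D ->
  `|v x y - v x0 y0| + 8 * (1 - v x0 y0) * `|u x y - u x0 y0| <=
  18000 * (v x0 y0 / y0) * D.
Proof.
move=> y00 y02 hD dx yy0.
have D0 : 0 <= D by have := normr_ge0 (y - y0); lra.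
have /andP[v0y v01] := disk_depth x0 (ltW y00) y02.
have v4 : 1 / 4 <= v x0 y0 / y0 by rewrite ler_pdivlMr //; lra.
have yb := yy0; rewrite ler_norml in yb.
(* Up to [3 / 2] the radius is at least [1 / 4], so the angle changes by at most [4 * D] and
   [edges_lipschitz] applies. Beyond it both heights exceed 1, the formulas are explicit, and the
   factor [1 - v], half the radius, tames the angle at the origin. *)
case: (leP y0 (3 / 2)) => y0_32.
  have dx4 : `|x - x0| <= 4 * D.
    have : 1 / 4 * `|x - x0| <= (1 - y0 / 2) * `|x - x0|.
      by apply: ler_wpM2r => //; lra.
    by lra.
  have hx : `|x - x0| <= y0 / 4 by apply: le_trans dx4 _; lra.
  have hy : `|y - y0| <= y0 / 4 by apply: le_trans yy0 _; lra.
  have [] := edges_lipschitz cpG y00 y02 hx hy.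
  have -> : (top x0 y0 - bot x0 y0) / y0 = 2 * (v x0 y0 / y0).
    by rewrite /depth; field; rewrite gt_eqF.
  have : 65 * (2 * (v x0 y0 / y0)) * (`|x - x0| + `|y - y0|) <= 780 * (v x0 y0 / y0 * D).
    rewrite (_ : 780 * _ = 65 * (2 * (v x0 y0 / y0)) * (6 * D)); last by ring.
    by apply: ler_wpM2l; lra.
  have -> : 18000 * (v x0 y0 / y0) * D = 18000 / 780 * (780 * (v x0 y0 / y0 * D)).
    by field; rewrite gt_eqF.
  move: (780 * _) => Q hQ /le_trans/(_ hQ) ht /le_trans/(_ hQ) hb.
  have [hv hu] := ler_half_combination ht hb.
  rewrite -!/(depth _ _ _ _ _) -!/(twist _ _ _ _ _) in hv hu.
  have : 8 * (1 - v x0 y0) * `|u x y - u x0 y0| <= 8 * Q.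
    by apply: ler_pM => //; lra.
  have : 0 <= Q by exact: le_trans hu.
  by lra.
have y1 : 1 <= y by lra.
have y01 : 1 <= y0 by lra.
have vE : v x y - v x0 y0 = (y - y0) / 4.
  by rewrite /depth !(top_edge_ge1 cpG) // !(bottom_edge_ge1 cpG) //; field.
have uE : u x y - u x0 y0 = x - x0.
  by rewrite /twist !(top_edge_ge1 cpG) // !(bottom_edge_ge1 cpG) //; field.
have v0E : 1 - v x0 y0 = (1 - y0 / 2) / 2.
  by rewrite /depth (top_edge_ge1 cpG) // (bottom_edge_ge1 cpG) //; field.
rewrite vE uE v0E normrM (@ger0_norm _ 4^-1) //.
rewrite (_ : 8 * _ * _ = 4 * ((1 - y0 / 2) * `|x - x0|)); last by field.
have : 1 / 4 * D <= v x0 y0 / y0 * D by apply: ler_wpM2r.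
by lra.
Qed.

Lemma disk_ext_lipschitz : exists2 C : R, 0 < C & forall z z0 : R * R,
  cmod z0 < 1 -> cmod z <= 1 -> cmod (z - z0) <= (1 - cmod z0) / 8 ->
  `|disk_ext z - disk_ext z0| <=
    C * ((1 - cmod (disk_ext z0)) / (1 - cmod z0)) * cmod (z - z0).
Proof.
exists 9000 => [|z z0]; first by rewrite ltr0n.
have [x0 e0] := polar_exists z0; set r0 := cmod z0 in e0 *.
have [x e xx0] := polar_near z x0; set r := cmod z in e *.
move=> r01 r1; set D := cmod (z - z0) => hD.
have r00 : 0 <= r0 by exact: cmod_ge0.
have rp : 0 <= r by exact: cmod_ge0.
have D0 : 0 <= D by exact: cmod_ge0.
have rr0 : `|r - r0| <= D by exact: ler_cmod_dist.
(* Moving [z] radially to radius [r0] costs at most [D], so the chord at radius [r0] is at most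
   [2 * D]; [polar_chord] bounds it below by twice the left-hand side. *)
have dx : r0 * `|x - x0| <= D.
  have h := polar_chord xx0.
  have : r0 * (2 * `|x - x0|) <= cmod (polar r0 x - polar r0 x0).
    apply: le_trans (ler_wpM2l r00 h) _.
    rewrite [X in _ <= X](@cmod_eq _ (r0 * cmod (polar 1 x - polar 1 x0))) //.
      by rewrite mulr_ge0 // cmod_ge0.
    by rewrite exprMn (cmod_sqr (_ - _)) /=; ring.
  have : cmod (polar r0 x - polar r0 x0) <= cmod (polar r0 x - z) + D.
    by rewrite -e0; have := ler_cmodD (polar r0 x - z) (z - z0); rewrite addrA subrK.
  have : cmod (polar r0 x - z) = `|r - r0|.
    rewrite e; apply: cmod_eq => //=; rewrite real_normK ?num_real //.
    have := cos2sin2 (2 * pi * x); move: (cos _) (sin _) => C S h'.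
    rewrite -!mulrBl !exprMn h'; ring.
  by lra.
rewrite e e0 cmod_disk_ext ?(ltW r01) // !disk_extE // {e e0}.
set y0 := 2 * (1 - r0); set y := 2 * (1 - r).
have y00 : 0 < y0 by rewrite /y0; lra.
have y02 : y0 <= 2 by rewrite /y0; lra.
have yy0 : `|y - y0| <= 2 * D.
  by move: rr0; rewrite !ler_norml /y /y0; lra.
have /andP[v0y v01] := disk_depth x0 (ltW y00) y02.
apply: le_trans (polar_lipschitz _ _ _ _) _.
have -> : `|1 - v x y - (1 - v x0 y0)| = `|v x y - v x0 y0|.
  by rewrite distrC; congr (`|_|); ring.
have -> : `|1 - v x0 y0| = 1 - v x0 y0 by rewrite ger0_norm //; lra.
have -> : `|s * u x y - s * u x0 y0| = `|u x y - u x0 y0|.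
  by rewrite -mulrBr normrM; case: s1 => ->; rewrite ?normrN normr1 mul1r.
have -> : 1 - (1 - v x0 y0) = v x0 y0 by ring.
have dE : 9000 * (v x0 y0 / (1 - r0)) * D = 18000 * (v x0 y0 / y0) * D.
  by rewrite /y0; field; lra.
rewrite dE; apply: depth_twist_lipschitz => //; first by rewrite /y0; lra.
by rewrite (_ : 1 - y0 / 2 = r0) // /y0; field.
Qed.

End disk_extension.

(** * Topology of the closed disk *)

(** The preimage of a closed set [C] under the inverse is the image of the compact set formed by [A]
    and [C], hence closed. Off [B] the inverse takes an arbitrary value in [A]. *)
Lemma compact_homeomorphism_on {T U : topologicalType} (A : set T) (B : set U)
    (h : T -> U) : hausdorff_space T -> hausdorff_space U -> compact A -> A !=set0 ->
  set_bij A B h -> {within A, continuous h} -> homeomorphism_on A B h.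
Proof.
move=> hT hU cA [a0 Aa0] hbij hc; split => //; have [hAB hinj hsurj] := hbij.
have ex (w : U) : exists z, A z /\ (B w -> h z = w).
  case: (pselect (B w)) => [/hsurj[z Az <-]|nB]; first by exists z.
  by exists a0.
have [g gP] := choice ex.
have gK : {in A, cancel h g}.
  move=> z; rewrite inE => Az; have [Ag hg] := gP (h z).
  by apply: hinj; rewrite ?inE //; apply: hg; exact: hAB.
exists g; split => //; apply/continuous_closedP => C cC.
apply/closed_subspaceP; exists (h @` (A `&` C)).
  apply: compact_closed => //; apply: continuous_compact.
    by apply: continuous_subspaceW hc => z [].
  exact: compact_closedI.
apply/seteqP; split => w [].
  move=> [z [Az Cz] <-] Bw; split => //=.
  by change (C (g (h z))); rewrite gK // inE.
move=> /= Cg Bw; split => //; have [Ag hg] := gP w.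
by exists (g w); [split|exact: hg].
Qed.

Lemma polar_ind {R : realType} (P : R * R -> Prop) :
  (forall r x, 0 <= r -> P (polar r x)) -> forall z, P z.
Proof. by move=> H z; have [x ->] := polar_exists z; apply: H; exact: cmod_ge0. Qed.

Section disk.
Context {R : realType}.

Lemma cmod_continuous : continuous (@cmod R).
Proof.
move=> z; apply/cvgrPdist_lt => e e0.
have e20 : 0 < e / 2 by rewrite divr_gt0.
apply: filterS (nbhsx_ballx z (e / 2) e20) => w; rewrite -ball_normE /= => zw.
apply: le_lt_trans (ler_cmod_dist _ _) _; apply: le_lt_trans (cmod_le_norm _) _.
by rewrite mulrC -ltr_pdivlMr.
Qed.

Lemma closed_disk_compact : compact (@closed_disk R).
Proof.
have cK : compact (`[-1, 1]%classic `*` `[-1, 1]%classic : set (R * R)).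
  by apply: compact_setX; exact: segment_compact.
apply: (subclosed_compact _ cK).
  apply: (@closed_comp _ _ (@cmod R) [set t | t <= 1]).
    by move=> z _; exact: cmod_continuous.
  exact: closed_le.
move=> z; rewrite /closed_disk /= => z1.
have := norm_le_cmod z; rewrite prod_normE ge_max => /andP[h1 h2].
by split; rewrite /= in_itv /= -ler_norml; apply: le_trans z1.
Qed.

Lemma dist_within_continuous (A : set (R * R)) (h : R * R -> R * R) :
  (forall z0, A z0 -> forall e, 0 < e -> exists2 d, 0 < d &
    forall z, A z -> cmod (z - z0) < d -> `|h z - h z0| < e) ->
  {within A, continuous h}.
Proof.
move=> H; apply/subspace_continuousP => z0 Az0; apply/cvgrPdist_lt => e e0.
have [d d0 hd] := H z0 Az0 e e0.
have d20 : 0 < d / 2 by rewrite divr_gt0.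
apply: filterS (nbhsx_ballx z0 (d / 2) d20) => z.
rewrite -ball_normE /= => zz0 Az; rewrite distrC; apply: hd => //.
apply: le_lt_trans (cmod_le_norm _) _; rewrite distrC mulrC.
by rewrite -ltr_pdivlMr.
Qed.
End disk.

(** * The extension is a locally Lipschitz homeomorphism *)

Section disk_homeomorphism.
Context {R : realType} {f G : R -> R} {c s : R} {phi : R * R -> R * R}.
Hypothesis cpG : convex_primitive f G c.
Hypothesis f_cont : continuous f.
Hypothesis s1 : s = 1 \/ s = -1.
Hypothesis phiE : forall x, phi (polar 1 x) = polar 1 (s * f x).
Hypothesis hphi : homeomorphism_on (@unit_circle R) (@unit_circle R) phi.

Local Notation h := (@disk_ext R f G c s).
Local Notation v := (depth f G c).
Local Notation u := (twist f G c).

Lemma depthDz (x y : R) (n : int) : v (x + n%:~R) y = v x y.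
Proof.
rewrite /depth (shift1_int (fun t => top_edgeD1 cpG y t)).
by rewrite (shift1_int (fun t => bottom_edgeD1 cpG y t)); congr (_ / 2); ring.
Qed.

Lemma twistDz (x y : R) (n : int) : u (x + n%:~R) y = u x y + n%:~R.
Proof.
rewrite /twist (shift1_int (fun t => top_edgeD1 cpG y t)).
by rewrite (shift1_int (fun t => bottom_edgeD1 cpG y t)); field.
Qed.

Lemma depth_twist_inj (x y x' y' : R) : 0 < y -> 0 < y' ->
  v x y = v x' y' -> u x y = u x' y' -> x = x' /\ y = y'.
Proof.
move=> y0 y'0 e1 e2; apply: (edges_inj cpG) => //;
  by move: e1 e2; rewrite /depth /twist; lra.
Qed.

Lemma depth_twist_surj (a b : R) : 0 < a -> a <= 1 ->
  exists x y, [/\ 0 < y, y <= 2, v x y = a & u x y = b].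
Proof.
move=> a0 a1.
have [||x [y [y0 y2 e1 e2]]] := @edges_surj _ _ _ _ cpG f_cont (b + a) (b - a); try lra.
by exists x, y; split => //; rewrite /depth /twist e1 e2; field.
Qed.

Lemma disk_ext_on_circle : {in @unit_circle R, h =1 phi}.
Proof.
move=> z; rewrite inE => z1; have [x e] := polar_exists z.
by rewrite e z1 (disk_ext_circle cpG) ?phiE.
Qed.

Lemma cmod_disk_ext_bounds (z : R * R) : cmod z <= 1 ->
  (1 - cmod z) / 2 <= 1 - cmod (h z) <= 1.
Proof.
move: z; apply: polar_ind => r x r0; rewrite cmod_polar // => r1.
rewrite (cmod_disk_ext cpG) // subKr.
by have := @disk_depth _ _ _ _ cpG x (2 * (1 - r)); lra.
Qed.

Lemma disk_ext0 : h 0 = 0.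
Proof.
have e x : (0 : R * R) = polar 0 x by rewrite /polar !mul0r.
have h12 : 1 <= 2 :> R by lra.
rewrite {1}(e 0) (disk_extE cpG) // subr0 mulr1 /depth.
rewrite (top_edge_ge1 cpG) // (bottom_edge_ge1 cpG) //.
by rewrite (_ : 1 - _ / 2 = 0) -?e //; field.
Qed.

Lemma disk_ext_gt0 (z : R * R) : 0 < cmod z -> cmod z <= 1 -> 0 < cmod (h z).
Proof.
move: z; apply: polar_ind => r x r0'; rewrite cmod_polar // => r0 r1.
rewrite (cmod_disk_ext cpG) //.
by have := @edges_gap_lt2 _ _ _ _ cpG x (2 * (1 - r)); rewrite /depth; lra.
Qed.

Lemma cmod_eq0 (z : R * R) : cmod z = 0 -> z = 0.
Proof.
by have [x e] := polar_exists z => z0; rewrite e z0 /polar !mul0r.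
Qed.

Lemma polar_cancel (r t t' : R) : r != 0 -> polar r t = polar r t' ->
  polar 1 t = polar 1 t'.
Proof. by move=> r0 [/(mulfI r0) e1 /(mulfI r0) e2]; rewrite /polar e1 e2. Qed.

(** When the image has modulus 1, both points are on the circle, where [phi] is injective. Otherwise
    both are interior: the origin is recognised by its image 0, and elsewhere the image determines
    depth and twist up to an integer turn. *)
Lemma disk_ext_inj : set_inj (@closed_disk R) h.
Proof.
move=> z z'; rewrite !inE /closed_disk /= => z1 z'1 hh.
have hm : cmod (h z) = cmod (h z') by rewrite hh.
have b := cmod_disk_ext_bounds z1; have b' := cmod_disk_ext_bounds z'1.
have z0 := cmod_ge0 z; have z'0 := cmod_ge0 z'.
case: (ltgtP (cmod (h z)) 1) => hz1.
- move: z0; rewrite le_eqVlt => /predU1P[z0|z0].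
    move: z'0; rewrite le_eqVlt => /predU1P[z'0|z'0].
      by rewrite (cmod_eq0 (esym z0)) (cmod_eq0 (esym z'0)).
    have := disk_ext_gt0 z'0 z'1; rewrite -hm (cmod_eq0 (esym z0)) disk_ext0.
    by rewrite (@cmod_eq _ 0) ?ltxx //= !expr0n addr0.
  have hz0 := disk_ext_gt0 z0 z1.
  have lt1 w : cmod w <= 1 -> cmod (h w) < 1 -> cmod w < 1.
    move=> w1 hw; rewrite lt_neqAle w1 andbT; apply/eqP => e.
    have [[hc _ _] _ _] := hphi; have := hc w e.
    rewrite /unit_circle /= -disk_ext_on_circle ?inE // => e'.
    by move: hw; rewrite e' ltxx.
  have lz := lt1 z z1 hz1; have lz' : cmod z' < 1 by apply: lt1; rewrite -?hm.
  move: hh hm hz0 lz lz' z'0 {z0 z1 z'1 hz1 b b' lt1}.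
  move: z; apply: polar_ind => r x r0'; move: z'; apply: polar_ind => r' x' r'0'.
  rewrite (cmod_polar x r0') (cmod_polar x' r'0') => hh' hm' hz0' lr lr' _.
  move: hh' hm' hz0'.
  rewrite !(cmod_disk_ext cpG) ?(ltW lr) ?(ltW lr') // !(disk_extE cpG) //.
  have y0 : 0 < 2 * (1 - r) by lra.
  have y'0 : 0 < 2 * (1 - r') by lra.
  move=> hh' hm' hz0'.
  have vv : v x (2 * (1 - r)) = v x' (2 * (1 - r')) by lra.
  rewrite vv in hh' hz0'.
  have [n un] := polar_sign_inj s1 (polar_cancel (lt0r_neq0 hz0') hh').
  rewrite -twistDz in un; rewrite -(depthDz _ _ n) in vv.
  have [xx yy] := depth_twist_inj y0 y'0 vv (esym un).
  have rr : r = r' by lra.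
  by rewrite -xx polarDz rr.
- by exfalso; clear hh; lra.
- case: hphi => -[_ hinj _] _ _.
  have c1 : cmod z = 1 by clear hh; lra.
  have c1' : cmod z' = 1 by clear hh; lra.
  by apply: hinj; rewrite ?inE // -!disk_ext_on_circle ?inE.
Qed.

Lemma disk_ext_bij : set_bij (@closed_disk R) (@closed_disk R) h.
Proof.
split; [|exact: disk_ext_inj|].
  move=> z z1; have := cmod_disk_ext_bounds z1.
  by rewrite /closed_disk /= in z1 *; lra.
move=> w w1; have [t e] := polar_exists w; rewrite /closed_disk /= in w1.
have w0 := cmod_ge0 w.
move: w1; rewrite le_eqVlt => /predU1P[w1|w1].
  case: hphi => -[_ _ hs] _ _; have [z z1 <-] := hs w w1.
  exists z; last by rewrite disk_ext_on_circle ?inE.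
  by rewrite /closed_disk /= z1.
have a0 : 0 < 1 - cmod w by lra.
have a1 : 1 - cmod w <= 1 by lra.
(* The image has angle [s * u], and [s * s = 1], so the twist sought is [s * t]. *)
have [x [y [y0 y2 vE uE]]] := depth_twist_surj (s * t) a0 a1.
exists (polar (1 - y / 2) x).
  by rewrite /closed_disk /= cmod_polar; lra.
rewrite (disk_extE cpG s1); last by lra.
rewrite (_ : 2 * _ = y); last by field.
rewrite vE uE subKr mulrA (_ : s * s = 1) ?mul1r -?e //.
by case: s1 => ->; ring.
Qed.

Lemma disk_ext_continuous : {within @closed_disk R, continuous h}.
Proof.
apply: dist_within_continuous => z0 z01 e e0; rewrite /closed_disk /= in z01.
move: z01; rewrite le_eqVlt => /predU1P[z01|z01].
  have [x0] := polar_exists z0; rewrite z01 => ez0.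
  (* The radius contributes one tenth of [e] and the angle eight tenths, by the constant 8 of
     [polar_lipschitz]. *)
  have e9 : 0 < e / 10 by lra.
  have [d d0 H] := edges_near_boundary cpG f_cont x0 e9.
  exists (d / 2); first by rewrite divr_gt0.
  move=> z z1 zz0; rewrite /closed_disk /= in z1.
  have [x ez xx0] := polar_near z x0; have z0' := cmod_ge0 z.
  have hr : 1 - cmod z <= cmod (z - z0).
    by have := ler_cmod_dist z z0; rewrite z01 ler_norml; lra.
  have hx : `|x - x0| <= cmod (z - z0).
    have := polar_chord xx0; rewrite -ez0.
    have := ler_cmodD (polar 1 x - z) (z - z0); rewrite addrA subrK.
    have : cmod (polar 1 x - z) = 1 - cmod z.
      rewrite {1}ez; apply: cmod_eq; first by lra.
      have := cos2sin2 (2 * pi * x) => h'.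
      by rewrite /= -!mulrBl !exprMn h'; ring.
    by lra.
  rewrite {1}ez (disk_extE cpG s1) // ez0 (disk_ext_circle cpG s1).
  have [] := H x (2 * (1 - cmod z)); try lra.
  move=> ht hb; apply: le_lt_trans (polar_lipschitz _ _ _ _) _.
  have [hv hu] := ler_half_combination (ltW ht) (ltW hb).
  rewrite subrr mul0r subr0 in hv.
  rewrite (_ : (f x0 + f x0) / 2 = f x0) in hu; last by field.
  rewrite normr1 mulr1 -mulrBr normrM.
  have -> : `|s| = 1 by case: s1 => ->; rewrite ?normrN normr1.
  rewrite mul1r (_ : 1 - _ - 1 = - v x (2 * (1 - cmod z))) ?normrN; last by ring.
  rewrite /depth /twist; lra.
have b := cmod_disk_ext_bounds (ltW z01).
have z00 : 0 < 1 - cmod z0 by lra.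
have [C C0 lipC] := disk_ext_lipschitz cpG s1.
pose K := C * ((1 - cmod (h z0)) / (1 - cmod z0)).
have K0 : 0 <= K by rewrite (mulr_ge0 (ltW C0)) // divr_ge0 //; lra.
have K1 : 0 < K + 1 by lra.
exists (Num.min ((1 - cmod z0) / 8) (e / (K + 1))).
  by rewrite lt_min !divr_gt0.
move=> z z1; rewrite lt_min => /andP[zd]; rewrite ltr_pdivlMr // => ze.
apply: le_lt_trans (lipC z z0 z01 z1 (ltW zd)) _.
rewrite -/K; apply: le_lt_trans ze; rewrite mulrC; apply: ler_wpM2l.
  exact: cmod_ge0.
by rewrite lerDl.
Qed.

Lemma disk_ext_homeomorphism :
  homeomorphism_on (@closed_disk R) (@closed_disk R) h.
Proof.
apply: compact_homeomorphism_on.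
- exact: norm_hausdorff.
- exact: norm_hausdorff.
- exact: closed_disk_compact.
- by exists 0; rewrite /closed_disk /= (@cmod_eq _ 0) //= !expr0n addr0.
- exact: disk_ext_bij.
- exact: disk_ext_continuous.
Qed.

Lemma disk_ext_locally_lipschitz : locally_lipschitz_on (@open_disk R) h.
Proof.
move=> z0; rewrite /open_disk /= => z01.
(* Two points of the ball are at modulus distance at most [4 * d], below the [(1 - cmod w) / 8]
   required by [disk_ext_lipschitz]. *)
pose d := (1 - cmod z0) / 64.
have d0 : 0 < d by rewrite divr_gt0 // subr_gt0.
exists (ball z0 d); first exact: nbhsx_ballx.
have [C C0 lipC] := disk_ext_lipschitz cpG s1.
have zU : (@open_disk R `&` ball z0 d) z0 by split => //; exact: ballxx.
apply: (@klipschitzW _ _ _ (C * 4 / (1 - cmod z0))).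
  by apply: (@globally_properfilter _ _ (z0, z0)); split.
move=> [z w] /= [[z1 zd] [w1 wd]]; rewrite /open_disk /= in z1 w1.
rewrite -ball_normE /= in zd wd.
have hz := cmod_le_norm (z0 - z); have hw := cmod_le_norm (z0 - w).
have hw' := ler_cmod_dist z0 w; rewrite ler_norml in hw'.
have hzw : cmod (z - w) <= cmod (z0 - z) + cmod (z0 - w).
  rewrite (cmodB z0); apply: le_trans (ler_cmodD _ _).
  by rewrite addrA subrK.
have hzw' := cmod_le_norm (z - w).
have w0 := cmod_ge0 w; have z00 := cmod_ge0 z0.
have b := cmod_disk_ext_bounds (ltW w1).
have zw8 : cmod (z - w) <= (1 - cmod w) / 8 by rewrite /d in zd wd; lra.
apply: le_trans (lipC z w w1 (ltW z1) zw8) _.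
have z0' : 0 < 1 - cmod z0 by lra.
have w0' : 0 < 1 - cmod w by lra.
have hwz : 1 - cmod z0 <= 2 * (1 - cmod w) by rewrite /d in wd; lra.
have q : (1 - cmod (h w)) / (1 - cmod w) <= 2 / (1 - cmod z0).
  rewrite ler_pdivrMr // mulrAC ler_pdivlMr //.
  apply: (@le_trans _ _ (1 * (1 - cmod z0))); last by rewrite mul1r.
  by apply: ler_wpM2r; lra.
apply: (@le_trans _ _ (C * (2 / (1 - cmod z0)) * (2 * `|z - w|))).
  apply: ler_pM => //; last by rewrite ler_pM2l.
    by rewrite (mulr_ge0 (ltW C0)) // divr_ge0 //; lra.
  exact: cmod_ge0.
rewrite (_ : _ * (2 * _) = C * 4 / (1 - cmod z0) * `|z - w|) //.
by field; rewrite gt_eqF.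
Qed.

End disk_homeomorphism.

(** * Operator norm of the differential *)

(** The differential is a choice among the maps satisfying a predicate; when there are none, the
    default value is the zero map. *)
Lemma diff_notdifferentiable {R : realType} {V W : normedModType R} (h : V -> W) z :
  ~ differentiable h z -> 'd h z = (fun=> 0) :> (V -> W).
Proof.
rewrite /diff; set P := (X in get X) => nd.
have [Pex|nP] := pselect (exists df, P df); last first.
  by rewrite getPN // => df Pdf; apply: nP; exists df.
by exfalso; apply/nd/diffP; exact: (getPex Pex).
Qed.

Lemma cmodZ {R : realType} (t : R) (z : R * R) : cmod (t *: z) = `|t| * cmod z.
Proof.
apply: cmod_eq; first by rewrite mulr_ge0 // cmod_ge0.
by rewrite [RHS]exprMn cmod_sqr real_normK ?num_real //= !exprMn mulrDr.
Qed.

(** Difference quotients along [w] bound the sup norm of the differential by [K]; returning to the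
    modulus costs the factor 2. At points without differentiability the differential is zero, so the
    bound holds everywhere. *)
Lemma diff_opnorm_le {R : realType} (h : R * R -> R * R) (z0 : R * R) (K d : R) :
  0 <= K -> 0 < d ->
  (forall z, cmod (z - z0) <= d -> `|h z - h z0| <= K * cmod (z - z0)) ->
  0 <= diff_opnorm h z0 <= 2 * K.
Proof.
move=> K0 d0 H.
pose S := [set cmod ('d h z0 w) | w in [set w | cmod w <= 1]].
have S0 : S 0.
  exists 0; first by rewrite /= (@cmod_eq _ 0) //= expr0n addr0.
  by rewrite linear0 (@cmod_eq _ 0) //= expr0n addr0.
have ubS : ubound S (2 * K).
  move=> _ [w /= w1 <-].
  case: (pselect (differentiable h z0)) => [hd|/diff_notdifferentiable ->]; last first.
    by rewrite (@cmod_eq _ 0) ?mulr_ge0 //= expr0n addr0.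
  apply: le_trans (cmod_le_norm _) _; rewrite ler_pM2l // -deriveE //.
  have hw : derivable h z0 w by exact: diff_derivable.
  apply/ler_addgt0Pr => e e0; rewrite addrC.
  have /cvgrPdist_lt/(_ _ e0) dc := hw.
  near (0 : R)^' => t.
  have lt : `|'D_w h z0 - t^-1 *: ((h \o shift z0) (t *: w) - h z0)| < e.
    by near: t; exact: dc.
  have t0 : t != 0 by near: t; exact: nbhs_dnbhs_neq.
  have td : `|t| <= d by near: t; exact: dnbhs0_le.
  have tp : 0 < `|t| by rewrite normr_gt0.
  rewrite -[X in `|X|](subrK (t^-1 *: ((h \o shift z0) (t *: w) - h z0))).
  apply: le_trans (ler_normD _ _) _; apply: lerD; first exact: ltW.
  rewrite normrZ normfV ler_pdivrMl //= mulrC.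
  have := H (t *: w + z0); rewrite addrK cmodZ => Ht.
  have tw : `|t| * cmod w <= `|t| by rewrite ler_piMr.
  apply: le_trans (Ht _) _; first exact: le_trans td.
  by rewrite ler_wpM2l.
rewrite /diff_opnorm; apply/andP; split; last by apply: sup_le_ub => //; exists 0.
by apply: sup_upper_bound => //; split; [exists 0|exists (2 * K)].
Unshelve. all: by end_near. Qed.

(** * Integral bounds from covers *)

Section cover.
Context {d : measure_display} {T : measurableType d} {R : realType}.
Variable mu : {measure set T -> \bar R}.
Local Open Scope ereal_scope.
Import HBNNSimple.

(* No measurability is assumed, the integral of a nonnegative function being a
   supremum over simple functions; [diff_opnorm] is not known to be measurable. *)
Lemma le_integral_lower (f g : T -> \bar R) :
  (forall x, 0 <= f x) -> (forall x, f x <= g x) ->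
  \int[mu]_x f x <= \int[mu]_x g x.
Proof.
move=> f0 fg; have g0 x : 0 <= g x by exact: le_trans (fg x).
rewrite !ge0_integralTE //; apply: ereal_sup_le => _ [k kf <-].
by exists k => // x; exact: le_trans (fg x).
Qed.

(** The double series of [A n j] times the indicator of [Q n j] is a measurable majorant of the
    integrand extended by zero. Monotone convergence integrates it term by term. *)
Lemma integral_le_cover (D : set T) (F : T -> \bar R) (N : nat -> nat)
    (A : nat -> nat -> R) (Q : nat -> nat -> set T) (B : nat -> R) (S : R) :
  (forall x, D x -> 0 <= F x) ->
  (forall n j, measurable (Q n j)) ->
  (forall n j, (0 <= A n j)%R) ->
  (forall x, D x -> exists n j, [/\ (j < N n)%N, Q n j x & F x <= (A n j)%:E]) ->
  (forall n, \sum_(0 <= j < N n) (A n j)%:E * mu (Q n j) <= (B n)%:E) ->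
  (forall n, (\sum_(0 <= i < n) B i <= S)%R) ->
  \int[mu]_(x in D) F x <= S%:E.
Proof.
move=> F0 mQ A0 FQ AB BS.
pose t n j : T -> \bar R := fun x => (A n j)%:E * (\1_(Q n j) x)%:E.
pose a n : T -> \bar R := fun x => \sum_(0 <= j < N n) t n j x.
have t0 n j x : 0 <= t n j x by rewrite mule_ge0 // lee_fin.
have a0 n x : 0 <= a n x by exact: sume_ge0.
have mt n j : measurable_fun [set: T] (t n j).
  apply: emeasurable_funM; first exact: measurable_cst.
  by apply/measurable_EFinP; exact: measurable_indic.
have ma n : measurable_fun [set: T] (a n).
  exact: emeasurable_sum.
rewrite integral_mkcond.
apply: (@le_trans _ _ (\int[mu]_x \sum_(0 <= n <oo) a n x)).
  apply: le_integral_lower => x; first exact: erestrict_ge0.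
  rewrite patchE; case: ifPn => [|_]; last by apply: nneseries_ge0 => n _ _.
  rewrite inE => /FQ[n [j [jn Qx Fx]]]; apply: le_trans Fx _.
  apply: (@le_trans _ _ (a n x)).
    rewrite /a big_mkord (bigD1 (Ordinal jn)) //= /t indicE mem_set // mule1.
    by rewrite leeDl //; apply: sume_ge0 => i _; exact: t0.
  apply: le_trans (nneseries_lim_ge n.+1 (fun m _ _ => a0 m x)).
  by rewrite big_nat_recr //= leeDr //; apply: sume_ge0 => i _; exact: a0.
rewrite integral_nneseries //.
have intE n : \int[mu]_x a n x <= (B n)%:E.
  rewrite /a ge0_integral_sum //; apply: le_trans (AB n).
  apply: lee_sum => j _; rewrite /t ge0_integralZl_EFin //; last first.
    by apply/measurable_EFinP; exact: measurable_indic.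
  by rewrite integral_indic // setIT.
apply: lime_le.
  by apply: is_cvg_nneseries => n _ _; exact: integral_ge0.
apply: nearW => n; apply: le_trans (_ : (\sum_(0 <= i < n) B i)%:E <= _); last first.
  by rewrite lee_fin.
by rewrite -sumEFin; apply: lee_sum.
Qed.
End cover.

Lemma powR_le_1D {R : realType} (a q : R) : 0 <= a -> 0 <= q -> q <= 1 -> a `^ q <= 1 + a.
Proof.
move=> a0 q0 q1; case: (leP a 1) => a1.
  apply: (@le_trans _ _ (1 `^ q)); last by rewrite powR1 lerDl.
  by apply: ge0_ler_powR => //; rewrite nnegrE.
apply: (@le_trans _ _ (a `^ 1)); first by apply: ler_powR => //; exact: ltW.
by rewrite powRr1 // lerDr.
Qed.

(** Since [v <= 1], the exponent of [v] may be lowered to [q], and [q <= 1] bounds the power [q] of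
    [v / y] by [1 + v / y]. The result is affine in the depth, so it can be summed over a shell. *)
Lemma integrand_le {R : realType} (p beta C d v y t : R) n : 1 <= p -> p * beta < 1 ->
  0 <= C -> 0 <= d -> 0 < v -> v <= 1 -> 0 < y -> (2 ^+ n.+1)^-1 < y -> v <= t ->
  d <= C * (v / y) ->
  d `^ p / v `^ (p * beta) <=
  C `^ p * (2 `^ (p - Num.min (p - p * beta) 1)) ^+ n.+1 * (1 + 2 ^+ n.+1 * t).
Proof.
move=> p1 pb C0 d0 v0 v1 y0 yn vt dC.
set q := Num.min _ _.
have q0 : 0 <= q by rewrite le_min; apply/andP; split; lra.
have q1 : q <= 1 by rewrite ge_min lexx orbT.
have qp : q <= p - p * beta by rewrite ge_min lexx.
have e0 : 0 < y^-1 by rewrite invr_gt0.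
have vn : v != 0 by rewrite gt_eqF.
have en : y^-1 != 0 by rewrite gt_eqF.
have p0 : 0 <= p by lra.
have vp : 0 < v `^ (p * beta) by exact: powR_gt0.
have yi : y^-1 <= 2 ^+ n.+1.
  by rewrite -[2 ^+ _]invrK lef_pV2 ?posrE ?invr_gt0 ?exprn_gt0 // ltW.
have vy0 : 0 <= v / y by rewrite mulr_ge0 // ltW.
have step1 : d `^ p / v `^ (p * beta) <= C `^ p * (v `^ (p - p * beta) * y^-1 `^ p).
  rewrite ler_pdivrMr //.
  apply: (@le_trans _ _ ((C * (v / y)) `^ p)).
    by apply: ge0_ler_powR; rewrite ?nnegrE // mulr_ge0.
  rewrite powRM // powRM ?(ltW v0) ?(ltW e0) // -!mulrA.
  rewrite [y^-1 `^ p * _]mulrC [v `^ _ * (v `^ _ * _)]mulrA.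
  by rewrite -powRD ?subrK // vn implybT.
apply: le_trans step1 _; rewrite -mulrA; apply: ler_wpM2l; first exact: powR_ge0.
apply: (@le_trans _ _ (v `^ q * y^-1 `^ p)).
  by apply: ler_wpM2r; [exact: powR_ge0|apply: ger_powR; rewrite ?v0].
have -> : v `^ q * y^-1 `^ p = y^-1 `^ (p - q) * (v / y) `^ q.
  rewrite powRM ?(ltW v0) ?(ltW e0) // mulrCA.
  by rewrite -powRD ?subrK // en implybT.
apply: ler_pM; rewrite ?powR_ge0 //.
  have -> : (2 `^ (p - q)) ^+ n.+1 = (2 ^+ n.+1) `^ (p - q).
    rewrite -powR_mulrn ?powR_ge0 // -powRrM mulrC powRrM powR_mulrn //.
  apply: ge0_ler_powR => //; rewrite ?nnegrE ?(ltW e0) ?exprn_ge0 //; lra.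
apply: le_trans (powR_le_1D vy0 q0 q1) _; rewrite lerD2l mulrC.
by apply: ler_pM => //; exact: ltW.
Qed.

(** * Whitney boxes of the disk *)

Section disk_cells.
Context {R : realType} {f G : R -> R} {c s : R}.
Hypothesis cpG : convex_primitive f G c.
Hypothesis s1 : s = 1 \/ s = -1.
Local Notation h := (@disk_ext R f G c s).

(* An upper bound for the depth of the image of the Whitney box of size [2 ^- n]
   over the angles between [j / 2 ^ n] and [j.+1 / 2 ^ n]. *)
Definition cell_depth n j : R :=
  (upper G c (j.+1%:R / 2 ^+ n) (2 ^+ n)^-1 -
   lower G c (j%:R / 2 ^+ n) (2 ^+ n)^-1) / 2 + (2 ^+ n)^-1 / 2.

Lemma pow2_inv_gt0 n : 0 < (2 ^+ n)^-1 :> R.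
Proof. by rewrite invr_gt0 exprn_gt0. Qed.

Lemma cell_depth_ge0 n j : 0 <= cell_depth n j.
Proof.
have y0 := pow2_inv_gt0 n.
have := width_ge0 cpG (j%:R / 2 ^+ n) y0.
have : upper G c (j%:R / 2 ^+ n) (2 ^+ n)^-1 <= upper G c (j.+1%:R / 2 ^+ n) (2 ^+ n)^-1.
  by apply: (upper_homo_x cpG) => //; rewrite ler_pM2r // ler_nat.
by rewrite /width /cell_depth; lra.
Qed.

(** The halved widths contribute at most [9 / 4], and the [2 ^ n] copies of half the box size
    contribute [1 / 2]. *)
Lemma sum_cell_depth n : \sum_(0 <= j < (2 ^ n)%N) cell_depth n j <= 3.
Proof.
have hs := width_sum n cpG; rewrite /cell_depth big_split /= -mulr_suml.
rewrite big_const_nat subn0 iter_addr_0 -[_ *+ (2 ^ n)]mulr_natr natrX.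
rewrite (_ : _ / 2 * 2 ^+ n = 1 / 2); first by lra.
by rewrite mulrAC mulVf // expf_neq0.
Qed.

(** The index [n] is the least one with the required lower bound on the height, and [j] is the
    integer part of [x * 2 ^ n]. The radial offset is at most one box size and the angular one at
    most 8, whence the 9. *)
Lemma disk_cell (z : R * R) : cmod z < 1 -> exists n j, [/\ (j < 2 ^ n)%N,
  (2 ^+ n.+1)^-1 < 2 * (1 - cmod z), 1 - cmod (h z) <= cell_depth n j &
  `|z - polar 1 (j%:R / 2 ^+ n)| <= 9 / 2 ^+ n].
Proof.
have [x' ez] := polar_exists z.
pose x := x' - (Num.floor x')%:~R.
have xb : 0 <= x < 1 by have := floor_itv x'; rewrite intrD /x; lra.
have {}ez : z = polar (cmod z) x by rewrite {1}ez /x -intrN polarDz.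
have := cmod_ge0 z; move: xb; move: x ez => x {x'}; move: (cmod z) => r -> {z}.
move=> /andP[x0 x1] r0 r1; rewrite (cmod_disk_ext cpG) ?(ltW r1) //.
rewrite subKr.
have y0 : 0 < 2 * (1 - r) by lra.
have y2 : 2 * (1 - r) <= 2 by lra.
have rE : r = 1 - (2 * (1 - r)) / 2 by field.
move: rE y0 y2; move: (2 * (1 - r)) => y -> y0 y2 {r0 r1}.
have ex : exists n, (2 ^+ n.+1)^-1 < y.
  exists (Num.truncn y^-1); rewrite -[ltRHS]invrK ltf_pV2 ?posrE ?invr_gt0 ?exprn_gt0 //.
  apply: lt_le_trans (truncnS_gt _) _.
  by rewrite -natrX ler_nat ltnW // ltn_expl.
case: (ex_minnP ex) => n hn mn.
(* Minimality bounds [y] above by the box size, except at level 0, which also takes in the heights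
   from 1 to 2; there the edges are explicit. *)
have yn : y <= (2 ^+ n)^-1 \/ n = 0%N /\ 1 <= y.
  case: n hn mn => [|n] hn mn; last first.
    by left; rewrite leNgt; apply/negP => /mn; rewrite ltnn.
  by rewrite expr0 invr1; case: (leP y 1) => [?|/ltW ?]; [left|right].
have e0 := pow2_inv_gt0 n.
have y2n : y <= 2 * (2 ^+ n)^-1.
  by case: yn => [|[n0 _]]; [lra|rewrite n0 expr0 invr1; lra].
have x2n : 0 <= x * 2 ^+ n by rewrite mulr_ge0 // exprn_ge0.
pose j := Num.truncn (x * 2 ^+ n).
have /andP[j1 j2] := truncn_itv x2n; rewrite -/j in j1 j2.
exists n, j; split => //.
- rewrite -(ltr_nat R) natrX; apply: le_lt_trans j1 _.
  by rewrite gtr_pMl // exprn_gt0.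
- have xj : j%:R / 2 ^+ n <= x by rewrite ler_pdivrMr // exprn_gt0.
  have xj1 : x <= j.+1%:R / 2 ^+ n by rewrite ler_pdivlMr ?exprn_gt0 // ltW.
  have hu : upper G c x y <= upper G c (j.+1%:R / 2 ^+ n) (2 ^+ n)^-1.
    case: yn => [yn|[n0 y1]].
      by apply: le_trans (upper_homo_y cpG x y0 yn) _; exact: (upper_homo_x cpG).
    by move: xj1; rewrite n0 expr0 invr1 !(upper_ge1 cpG) // lerD2r.
  have hl : lower G c (j%:R / 2 ^+ n) (2 ^+ n)^-1 <= lower G c x y.
    case: yn => [yn|[n0 y1]].
      by apply: le_trans (lower_nhomo_y cpG x y0 yn); exact: (lower_homo_x cpG).
    by move: xj; rewrite n0 expr0 invr1 !(lower_ge1 cpG) // !lerD2r.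
  by rewrite /depth top_edge_gt0 // bottom_edge_gt0 // /cell_depth; lra.
apply: le_trans (polar_lipschitz _ _ _ _) _.
have -> : `|1 - y / 2 - 1| = y / 2.
  by rewrite addrAC subrr add0r normrN ger0_norm //; lra.
have : `|x - j%:R / 2 ^+ n| <= (2 ^+ n)^-1.
  rewrite ger0_norm; last by rewrite subr_ge0 ler_pdivrMr // exprn_gt0.
  by rewrite lerBlDl -[X in _ + X]mul1r -mulrDl natr1 ler_pdivlMr ?exprn_gt0 // ltW.
by rewrite normr1; lra.
Qed.
End disk_cells.

Lemma geometric_sum_le {R : realType} (r : R) n : 0 <= r -> r < 1 ->
  \sum_(0 <= i < n) r ^+ i <= 1 / (1 - r).
Proof.
move=> r0 r1; have r1' : 0 < 1 - r by lra.
rewrite ler_pdivlMr //.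
have -> : (\sum_(0 <= i < n) r ^+ i) * (1 - r) = 1 - r ^+ n.
  elim: n => [|n IH]; first by rewrite big_geq // mul0r expr0 subrr.
  by rewrite big_nat_recr //= mulrDl IH exprS; ring.
by rewrite gerBl exprn_ge0.
Qed.

Definition square {R : realType} (a : R * R) (e : R) : set (R * R) :=
  `[a.1 - e, a.1 + e] `*` `[a.2 - e, a.2 + e].

Lemma norm_le_square {R : realType} (a z : R * R) e : `|z - a| <= e -> square a e z.
Proof.
rewrite prod_normE ge_max /= => /andP[h1 h2].
by split; rewrite /= in_itv /= -ler_distl.
Qed.

Section measure_square.
Context {R : realType}.
Local Notation leb := (@lebesgue_measure R).

Lemma measurable_square (a : R * R) e :
  measurable (square a e : set (measurableTypeR R * measurableTypeR R)%type).
Proof. by apply: measurableX; exact: measurable_itv. Qed.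

Lemma measure_square (a : R * R) e : 0 <= e ->
  (leb \x leb)%E (square a e) = ((2 * e) ^+ 2)%:E.
Proof.
move=> e0; rewrite product_measure1E; [|exact: measurable_itv|exact: measurable_itv].
have itvE (t : R) : leb `[t - e, t + e]%classic = (2 * e)%:E.
  have -> : leb `[t - e, t + e]%classic = (if ((t - e)%:E < (t + e)%:E)%E
      then (t + e)%:E - (t - e)%:E else 0)%E.
    exact: (lebesgue_measure_itv `[t - e, t + e]).
  rewrite lte_fin; case: ltP => h; first by rewrite -EFinD; congr (_%:E); ring.
  by congr (_%:E); lra.
transitivity ((2 * e)%:E * (2 * e)%:E)%E; last by rewrite -EFinM.
by congr (_ * _)%E; exact: itvE.
Qed.
End measure_square.

(** * Finiteness of the integral *)

Section disk_integral.
Context {R : realType} {f G : R -> R} {c s : R}.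
Hypothesis cpG : convex_primitive f G c.
Hypothesis s1 : s = 1 \/ s = -1.
Local Notation h := (@disk_ext R f G c s).

Lemma diff_opnorm_disk_ext : exists2 C : R, 0 <= C & forall z, cmod z < 1 ->
  0 <= diff_opnorm h z <= C * ((1 - cmod (h z)) / (2 * (1 - cmod z))).
Proof.
have [C C0 lipC] := disk_ext_lipschitz cpG s1.
exists (4 * C) => [|z z1]; first by rewrite mulr_ge0 // ltW.
have b := cmod_disk_ext_bounds cpG s1 (ltW z1).
have z1' : 0 < 1 - cmod z by rewrite subr_gt0.
have -> : 4 * C * ((1 - cmod (h z)) / (2 * (1 - cmod z))) =
    2 * (C * ((1 - cmod (h z)) / (1 - cmod z))) by field; rewrite gt_eqF.
apply: (@diff_opnorm_le _ _ _ _ ((1 - cmod z) / 8)).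
- by rewrite (mulr_ge0 (ltW C0)) // divr_ge0 //; lra.
- by rewrite divr_gt0.
move=> w wz; apply: lipC => //.
by have := ler_cmod_dist w z; rewrite ler_norml; lra.
Qed.

Lemma disk_ext_integral (p beta : R) : 1 <= p -> p < 2 -> p * beta < 1 ->
  (\int[@lebesgue_measure2 R]_(z in @open_disk R)
    ((diff_opnorm h z `^ p) / ((1 - cmod (h z)) `^ (p * beta)))%:E < +oo)%E.
Proof.
move=> p1 p2 pb; have [C C0 dC] := diff_opnorm_disk_ext.
pose b : R := 2 `^ (p - Num.min (p - p * beta) 1).
have b0 : 0 < b by exact: powR_gt0.
(* Both [p * beta < 1] and [p < 2] enter here; they make the geometric ratio [b / 2] of the shells
   less than 1. *)
have b2 : b < 2.
  have e1 : p - Num.min (p - p * beta) 1 < 1.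
    by rewrite ltrBlDl -ltrBlDr lt_min; apply/andP; split; lra.
  have two1 : 1 < 2 :> R by lra.
  rewrite /b /powR gt_eqF // -[ltRHS]lnK ?posrE // ltr_expR.
  by rewrite gtr_pMl // ln_gt0.
pose A n j := C `^ p * b ^+ n.+1 * (1 + 2 ^+ n.+1 * @cell_depth R G c n j).
pose Q n (j : nat) := square (polar 1 (j%:R / 2 ^+ n)) (9 / 2 ^+ n : R).
(* The squares of level [n] have side [18 / 2 ^ n], and [7 = 1 + 2 * 3] with 3 the bound of
   [sum_cell_depth]. *)
pose K := 7 * 18 ^+ 2 * C `^ p * b.
pose B n := K * (b / 2) ^+ n.
apply: (@le_lt_trans _ _ (K * (1 / (1 - b / 2)))%:E); last exact: ltry.
apply: (@integral_le_cover _ _ R (@lebesgue_measure R \x @lebesgue_measure R)%E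
  _ _ (fun n => 2 ^ n)%N A Q B).
- by move=> z _; rewrite lee_fin divr_ge0 ?powR_ge0.
- by move=> n j; exact: measurable_square.
- move=> n j; have := cell_depth_ge0 cpG n j => cd.
  rewrite mulr_ge0 ?mulr_ge0 ?powR_ge0 ?exprn_ge0 ?(ltW b0) //.
  by rewrite addr_ge0 // mulr_ge0 // exprn_ge0.
- move=> z z1; have [n [j [jn yn vn zn]]] := disk_cell cpG s1 z1.
  exists n, j; split => //; first exact: norm_le_square.
  have /andP[d0 d1] := dC z z1.
  have bd := cmod_disk_ext_bounds cpG s1 (ltW z1).
  rewrite /open_disk /= in z1.
  by rewrite lee_fin; apply: (integrand_le p1 pb C0 d0 _ _ _ yn vn d1); lra.
- move=> n.
  have e0 : 0 <= 9 / 2 ^+ n :> R by rewrite divr_ge0 // exprn_ge0.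
  rewrite (eq_bigr (fun j => (A n j * (2 * (9 / 2 ^+ n)) ^+ 2)%:E)); last first.
    by move=> j _; rewrite [RHS]EFinM; congr (_ * _)%E; exact: measure_square.
  rewrite sumEFin lee_fin -mulr_suml /A -mulr_sumr big_split /= -mulr_sumr.
  have P0 : 0 < 2 ^+ n :> R by rewrite exprn_gt0.
  have -> : \sum_(0 <= j < (2 ^ n)%N) 1 = 2 ^+ n :> R.
    by rewrite big_const_nat subn0 iter_addr_0 natrX.
  have := sum_cell_depth cpG n; set S := \sum_(_ <= _ < _) _ => S3.
  have -> : C `^ p * b ^+ n.+1 * (2 ^+ n + 2 ^+ n.+1 * S) * (2 * (9 / 2 ^+ n)) ^+ 2 =
      C `^ p * b ^+ n.+1 * 18 ^+ 2 / 2 ^+ n * (1 + 2 * S).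
    rewrite [2 ^+ n.+1]exprS; move: (2 ^+ n) P0 (b ^+ n.+1) => P P0 bn.
    by field; rewrite gt_eqF.
  have -> : B n = C `^ p * b ^+ n.+1 * 18 ^+ 2 / 2 ^+ n * 7.
    rewrite /B /K expr_div_n [b ^+ n.+1]exprS; move: (2 ^+ n) P0 (b ^+ n) => P P0 bn.
    by field; rewrite gt_eqF.
  apply: ler_wpM2l; last by lra.
  rewrite divr_ge0 ?(ltW P0) // mulr_ge0 ?mulr_ge0 ?powR_ge0 ?exprn_ge0 ?(ltW b0) //.
- move=> n; rewrite /B -mulr_sumr ler_wpM2l //.
    by rewrite /K !mulr_ge0 ?powR_ge0 ?exprn_ge0 ?(ltW b0).
  apply: geometric_sum_le; lra.
Qed.
End disk_integral.

Unset Implicit Arguments.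

Theorem theorem1p4 (R : realType) (p beta : R) (hp1 : 1 <= p) (hp2 : p < 2)
    (hpbeta : p * beta < 1) (phi : R * R -> R * R)
    (hphi : homeomorphism_on (@unit_circle R) (@unit_circle R) phi) :
  exists h : R * R -> R * R,
    [/\ homeomorphism_on (@closed_disk R) (@closed_disk R) h,
        {in @unit_circle R, h =1 phi},
        locally_lipschitz_on (@open_disk R) h &
        (\int[@lebesgue_measure2 R]_(z in @open_disk R)
           ((diff_opnorm h z `^ p) / ((1 - cmod (h z)) `^ (p * beta)))%:E
         < +oo)%E].
Proof.
have [s [f [s1 f_homo f_cont f1 phiE]]] := circle_lift hphi.
have [G [c cpG]] := exists_convex_primitive f_homo f_cont f1.
exists (@disk_ext R f G c s); split.
- exact: (disk_ext_homeomorphism cpG f_cont s1 phiE hphi).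
- exact: (disk_ext_on_circle cpG s1 phiE).
- exact: (disk_ext_locally_lipschitz cpG s1).
- exact: (disk_ext_integral cpG s1).
Qed.
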